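(* Let $Ath:=\Diamond\Diamond p\to\square\Diamond p$, and let $\Lambda$ be either $\mathbf{K}+Ath$ or $\mathbf{K}+\square^n\bot+Ath$ for some $n\geq 1$. Then the 1-variable fragments $\mathbf{Q}\Lambda\!-\!1$ and $\mathbf{Q}\Lambda\mathbf{C}\!-\!1$ are decidable.
   Context: All propositional modal logics are normal; $\Lambda$ is in the language with the modality $\square$ (dual $\Diamond$). $L+A$ denotes the smallest normal modal logic (or, for predicate logics, smallest modal predicate logic) containing $L$ and the formula $A$; $\mathbf{K}$ is the minimal normal modal logic; $\square^n$ is $\square$ iterated $n$ times. Modal predicate formulas are built from predicate letters (no function symbols, constants or equality; 0-ary letters serve as proposition letters) with Boolean connectives, quantifiers and $\square$. A modal predicate logic is a set of such formulas containing the standard classical first-order axioms and the axiom $\square(p\to q)\to(\square p\to\square q)$, and closed under modus ponens, generalization, necessitation and predicate substitution. $\mathbf{Q}\Lambda$ is the smallest modal predicate logic containing $\Lambda$, and $\mathbf{Q}\Lambda\mathbf{C}:=\mathbf{Q}\Lambda+(\forall x\,\square P(x)\to\square\,\forall x\,P(x))$ (the Barcan axiom). A 1-variable formula is one constructed from a single individual variable $x$ and monadic predicate letters. For a 1-variable formula $A$, $A_*$ is the bimodal propositional formula (with modalities $\square$, $\blacksquare$) obtained by replacing every atom $P_i(x)$ with a proposition letter $p_i$ and every quantifier $\forall x$ with $\blacksquare$. For a modal predicate logic $L$, its 1-variable fragment is $L\!-\!1:=\{A_*\mid A\in L,\ A\text{ is 1-variable}\}$. *)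

(* Defs.v *)
From mathcomp Require Import all_boot classical_sets.
Set Implicit Arguments.
Unset Strict Implicit.
Unset Printing Implicit Defensive.

Local Open Scope classical_set_scope.

(** * Propositional modal logics *)

Inductive pform : Type :=
| PVar of nat
| PBot
| PImp of pform & pform
| PBox of pform.

Definition PNot A := PImp A PBot.
Definition PDia A := PNot (PBox (PNot A)).

Fixpoint prop_subst (s : nat -> pform) (A : pform) : pform :=
  match A with
  | PVar i => s i
  | PBot => PBot
  | PImp B C => PImp (prop_subst s B) (prop_subst s C)
  | PBox B => PBox (prop_subst s B)
  end.

(* The first three clauses axiomatize classical propositional logic, with
   [~ A := A -> _|_] and the other Boolean connectives defined as usual. *)
Record normal_logic (L : set pform) : Prop := NormalLogic {
  normal_ax1 : forall A B, L (PImp A (PImp B A));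
  normal_ax2 : forall A B C,
    L (PImp (PImp A (PImp B C)) (PImp (PImp A B) (PImp A C)));
  normal_dne : forall A, L (PImp (PNot (PNot A)) A);
  normal_K : L (PImp (PBox (PImp (PVar 0) (PVar 1)))
                     (PImp (PBox (PVar 0)) (PBox (PVar 1))));
  normal_mp : forall A B, L (PImp A B) -> L A -> L B;
  normal_nec : forall A, L A -> L (PBox A);
  normal_subst : forall s A, L A -> L (prop_subst s A) }.

Definition logicK : set pform := smallest normal_logic set0.

Definition plus (L : set pform) (A : pform) : set pform :=
  smallest normal_logic (L `|` [set A]).

Definition Ath : pform :=
  PImp (PDia (PDia (PVar 0))) (PBox (PDia (PVar 0))).

(** * Modal predicate formulas

    Individual variables are de Bruijn indices: below [k] quantifiers, the
    indices [0, ..., k-1] are bound, [0] by the innermost one, and the index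
    [k + j] is the free variable x_j.  Formulas are thus identified up to
    renaming of bound variables.

    [Atom i ys] is the i-th predicate letter of arity [size ys] applied to
    [ys]: letters of different arities are different even when they share the
    number [i], and [Atom i [::]] is a proposition letter. *)

Inductive form : Type :=
| Atom of nat & seq nat
| Bot
| Imp of form & form
| Box of form
| All of form.

Definition Not A := Imp A Bot.

Definition up (r : nat -> nat) (k : nat) : nat :=
  if k is k'.+1 then (r k').+1 else 0.

(* Capture-avoiding replacement of each free variable x_j by x_(r j). *)
Fixpoint rename (r : nat -> nat) (A : form) : form :=
  match A with
  | Atom i ys => Atom i (map r ys)
  | Bot => Bot
  | Imp B C => Imp (rename r B) (rename r C)
  | Box B => Box (rename r B)
  | All B => All (rename (up r) B)
  end.

(* The matrix [A] of [All A] with its quantified variable replaced by x_y. *)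
Definition inst (y : nat) (A : form) : form :=
  rename (fun k => if k is k'.+1 then k' else y) A.

(* [A] placed below a quantifier that binds none of its variables. *)
Definition shift (A : form) : form := rename succn A.

(* Simultaneous predicate substitution.  The formula [s i n] replaces the i-th
   n-ary letter: its indices [0, ..., n-1] stand for the n argument places and
   its index [n + j] for the parameter x_j, which must not be captured; hence
   the renumbering of parameters when a quantifier is crossed.  In an atom,
   [nth (k - size ys) ys k] is the k-th argument if [k < size ys], and the
   parameter [k - size ys] otherwise. *)
Fixpoint pred_subst (s : nat -> nat -> form) (A : form) : form :=
  match A with
  | Atom i ys => rename (fun k => nth (k - size ys) ys k) (s i (size ys))
  | Bot => Bot
  | Imp B C => Imp (pred_subst s B) (pred_subst s C)
  | Box B => Box (pred_subst s B)
  | All B =>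
      All (pred_subst
             (fun i n => rename (fun k => if k < n then k else k.+1) (s i n)) B)
  end.

(* In [mpl_allK] the antecedent [A] does not depend on the quantified variable,
   which is expressed by [shift].  [mpl_gen] generalizes over x_0 (the other
   free variables being renumbered accordingly); generalization over any other
   variable follows by [mpl_gen], [mpl_inst] and [mpl_mp]. *)
Record modal_predicate_logic (L : set form) : Prop := ModalPredicateLogic {
  mpl_ax1 : forall A B, L (Imp A (Imp B A));
  mpl_ax2 : forall A B C,
    L (Imp (Imp A (Imp B C)) (Imp (Imp A B) (Imp A C)));
  mpl_dne : forall A, L (Imp (Not (Not A)) A);
  mpl_inst : forall A y, L (Imp (All A) (inst y A));
  mpl_allK : forall A B, L (Imp (All (Imp (shift A) B)) (Imp A (All B)));
  mpl_K : L (Imp (Box (Imp (Atom 0 [::]) (Atom 1 [::])))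
                 (Imp (Box (Atom 0 [::])) (Box (Atom 1 [::]))));
  mpl_mp : forall A B, L (Imp A B) -> L A -> L B;
  mpl_gen : forall A, L A -> L (All A);
  mpl_nec : forall A, L A -> L (Box A);
  mpl_subst : forall s A, L A -> L (pred_subst s A) }.

Fixpoint form_of_pform (A : pform) : form :=
  match A with
  | PVar i => Atom i [::]
  | PBot => Bot
  | PImp B C => Imp (form_of_pform B) (form_of_pform C)
  | PBox B => Box (form_of_pform B)
  end.

Definition Q (L : set pform) : set form :=
  smallest modal_predicate_logic (form_of_pform @` L).

Definition Barcan : form :=
  Imp (All (Box (Atom 0 [:: 0]))) (Box (All (Atom 0 [:: 0]))).

Definition QC (L : set pform) : set form :=
  smallest modal_predicate_logic (Q L `|` [set Barcan]).

(** * One-variable fragments *)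

(* With a single variable name x, an occurrence of x is bound by the innermost
   quantifier above it, or is free if there is none.  In both cases its de
   Bruijn index is 0 (x being x_0), and conversely. *)
Fixpoint one_variable (A : form) : bool :=
  match A with
  | Atom _ ys => ys == [:: 0]
  | Bot => true
  | Imp B C => one_variable B && one_variable C
  | Box B | All B => one_variable B
  end.

Inductive bform : Type :=
| BVar of nat
| BBot
| BImp of bform & bform
| BBox of bform
| BBlackBox of bform.

Fixpoint star (A : form) : bform :=
  match A with
  | Atom i _ => BVar i
  | Bot => BBot
  | Imp B C => BImp (star B) (star C)
  | Box B => BBox (star B)
  | All B => BBlackBox (star B)
  end.

Definition one_variable_fragment (L : set form) : set bform :=
  [set star A | A in [set A | L A /\ one_variable A]].

(** * Decidability *)

(* The total recursive functions: minimization is applied to regular functions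
   only. *)
Inductive recursive : forall n, (n.-tuple nat -> nat) -> Prop :=
| rec_zero : @recursive 0 (fun=> 0)
| rec_succ : @recursive 1 (fun v => (thead v).+1)
| rec_proj n (i : 'I_n) : @recursive n (fun v => tnth v i)
| rec_comp m n (f : m.-tuple nat -> nat) (g : 'I_m -> n.-tuple nat -> nat) :
    recursive f -> (forall i, recursive (g i)) ->
    @recursive n (fun v => f [tuple g i v | i < m])
| rec_primrec n (f : n.-tuple nat -> nat) (h : n.+2.-tuple nat -> nat)
    (g : n.+1.-tuple nat -> nat) :
    recursive f -> recursive h ->
    (forall v : n.-tuple nat, g [tuple of 0 :: v] = f v) ->
    (forall k (v : n.-tuple nat), g [tuple of k.+1 :: v] =
                 h [tuple of k :: g [tuple of k :: v] :: v]) ->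
    recursive g
| rec_mu n (f : n.+1.-tuple nat -> nat) (g : n.-tuple nat -> nat) :
    recursive f ->
    (forall v : n.-tuple nat, f [tuple of g v :: v] = 0 /\
               forall k, k < g v -> f [tuple of k :: v] <> 0) ->
    recursive g.

(* Cantor's pairing function. *)
Definition pair_code (a b : nat) : nat := 'C((a + b).+1, 2) + a.

Fixpoint code (A : bform) : nat :=
  match A with
  | BVar i => pair_code 0 i
  | BBot => pair_code 1 0
  | BImp B C => pair_code 2 (pair_code (code B) (code C))
  | BBox B => pair_code 3 (code B)
  | BBlackBox B => pair_code 4 (code B)
  end.

Lemma pair_code_inj a b c d :
  pair_code a b = pair_code c d -> a = c /\ b = d.
Proof.
have lt_pair x y z t : x + y < z + t -> pair_code x y < pair_code z t.
  move=> lt_s; rewrite /pair_code.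
  apply: (@leq_trans 'C((x + y).+2, 2)).
    by rewrite [ltnRHS]binS bin1 ltn_add2l ltnS leq_addr.
  by apply: leq_trans (leq_addr _ _); apply: leq_bin2l.
move=> e; have es : a + b = c + d.
  case: (ltngtP (a + b) (c + d)) => // /lt_pair; by rewrite e ltnn.
move: e; rewrite /pair_code es => /addnI eac; split=> //.
by move: es; rewrite eac => /addnI.
Qed.

Lemma code_inj : injective code.
Proof.
elim=> [i||B IB C IC|B IB|B IB] [j||B' C'|B'|B'] //= /pair_code_inj [] //.
- by move=> _ ->.
- by move=> _ /pair_code_inj [/IB -> /IC ->].
- by move=> _ /IB ->.
- by move=> _ /IB ->.
Qed.

(* The characteristic function of [S], read through [code], is recursive. *)
Definition decidable_set (S : set bform) : Prop :=
  exists2 chi : 1.-tuple nat -> nat, recursive chi &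
    forall A, (S A -> chi [tuple code A] = 1) /\
              (~ S A -> chi [tuple code A] = 0).

(* Main.v *)
Require Import Defs.
From mathcomp Require Import all_boot boolp classical_sets.
Set Implicit Arguments.
Unset Strict Implicit.
Unset Printing Implicit Defensive.

(** Rooted frames of Ath unravel to sequences of levels V_0, V_1, ... in which
    every world of V_k sees exactly V_(k+1).  The fragments have a finite model
    property over such frames, with expanding domains for Q and constant ones
    for QC.

    In the canonical model of the fragment, the clusters of the S5 modality play
    the role of worlds.  Any two points reached from the same point in the same
    number of steps have the same successors, by Ath; hence the points that
    represent an individual at the worlds of one level can be chosen
    independently of one another, and the individual is given by the level at
    which it appears and its first point [y].  Only finitely much of this
    matters for formulas with code at most [A]: the type of a point, the set of
    types realized in its cluster, and the kind of [y], i.e., for each [n], the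
    pairs (set of types of the cluster, type) of the points reached from [y] in
    [n] steps.  A finite model is made of these data; its size is bounded by an
    elementary function of [A].

    The existence of a countermodel up to that bound is a bounded arithmetical
    condition, finite relations being coded by the bits of a number; such
    conditions are recursive. *)

(** * Recursive functions and bounded formulas *)

Lemma eq_recursive n (f g : n.-tuple nat -> nat) :
  f =1 g -> recursive f -> recursive g.
Proof. by move=> /funext ->. Qed.

Lemma recursive_const n c : recursive (fun _ : n.-tuple nat => c).
Proof.
elim: c => [|c IHc].
  apply: eq_recursive (rec_comp (g := fun _ _ => 0) rec_zero _) => //.
  by case.
apply: eq_recursive (rec_comp (g := fun _ _ => c) rec_succ _) => // v.
by rewrite /thead tnth_mktuple.
Qed.

Lemma recursive_nth n i : recursive (fun v : n.-tuple nat => nth 0 v i).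
Proof.
case: (ltnP i n) => [lt_in|le_ni].
  by apply: eq_recursive (rec_proj (Ordinal lt_in)) => v; rewrite (tnth_nth 0).
by apply: eq_recursive (recursive_const n 0) => v; rewrite nth_default ?size_tuple.
Qed.

Definition recursive2 (f : nat -> nat -> nat) :=
  recursive (fun v : 2.-tuple nat => f (nth 0 v 0) (nth 0 v 1)).

Lemma recursive_comp1 (f : nat -> nat) n (a : n.-tuple nat -> nat) :
  recursive (fun v : 1.-tuple nat => f (nth 0 v 0)) -> recursive a ->
  recursive (fun v => f (a v)).
Proof.
move=> rf ra; apply: eq_recursive (rec_comp rf (fun=> ra)) => v.
by rewrite (nth_mktuple _ 0 ord0).
Qed.

Lemma recursive_comp2 f n (a b : n.-tuple nat -> nat) :
  recursive2 f -> recursive a -> recursive b ->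
  recursive (fun v => f (a v) (b v)).
Proof.
move=> rf ra rb.
apply: eq_recursive (rec_comp (g := fun i => if i == 0 :> nat then a else b) rf _).
  by move=> v; rewrite (nth_mktuple _ 0 ord0) (nth_mktuple _ 0 ord_max).
by move=> i; case: eqP.
Qed.

(** The number of rounds is itself a recursive function [b], which is fed by composition into the
    counter argument of [rec_primrec]. *)
Lemma recursive_nat_rec n (b f : n.-tuple nat -> nat) (h : n.+2.-tuple nat -> nat) :
  recursive b -> recursive f -> recursive h ->
  recursive (fun v => nat_rec (fun=> nat) (f v)
    (fun k acc => h [tuple of k :: acc :: v]) (b v)).
Proof.
move=> rb rf rh.
pose g (w : n.+1.-tuple nat) := let v := [tuple of behead w] in
  nat_rec (fun=> nat) (f v) (fun k acc => h [tuple of k :: acc :: v]) (thead w).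
have tl k (v : n.-tuple nat) : [tuple of behead [tuple of k :: v]] = v.
  exact: val_inj.
have rg : recursive g.
  apply: (rec_primrec rf rh) => [v|k v]; rewrite /g !theadE ?tl //=.
apply: eq_recursive (rec_comp
  (g := fun i => if unlift ord0 i is Some j then fun v : n.-tuple nat => tnth v j else b) rg _).
  move=> v; set w := mktuple _.
  have -> : w = [tuple of b v :: v].
    apply: eq_from_tnth => i; rewrite tnth_mktuple.
    case: unliftP => [j ->|->]; last by rewrite tnth0.
    by rewrite tnthS.
  by rewrite /g tl theadE.
move=> i; case: unliftP => [j _|_] //; exact: rec_proj.
Qed.

Lemma recursive_succ n (a : n.-tuple nat -> nat) :
  recursive a -> recursive (fun v => (a v).+1).
Proof.
move=> ra; apply: (recursive_comp1 (f := succn)) => //.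
by apply: eq_recursive rec_succ => v; rewrite /thead (tnth_nth 0).
Qed.

Lemma recursive2_add : recursive2 addn.
Proof.
apply: eq_recursive (recursive_nat_rec (recursive_nth 2 1) (recursive_nth 2 0)
  (recursive_succ (recursive_nth 4 1))) => v /=.
by elim: (nth 0 v 1) => [|k /= ->]; rewrite ?addn0 ?addnS.
Qed.

Lemma recursive2_mul : recursive2 muln.
Proof.
apply: eq_recursive (recursive_nat_rec (recursive_nth 2 1) (recursive_const 2 0)
  (recursive_comp2 recursive2_add (recursive_nth 4 2) (recursive_nth 4 1))) => v /=.
by elim: (nth 0 v 1) => [|k /= ->]; rewrite ?muln0 ?mulnS.
Qed.

Lemma recursive2_exp : recursive2 expn.
Proof.
apply: eq_recursive (recursive_nat_rec (recursive_nth 2 1) (recursive_const 2 1)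
  (recursive_comp2 recursive2_mul (recursive_nth 4 2) (recursive_nth 4 1))) => v /=.
by elim: (nth 0 v 1) => [|k /= ->]; rewrite ?expnS.
Qed.

Lemma recursive_pred : recursive (fun v : 1.-tuple nat => (nth 0 v 0).-1).
Proof.
apply: eq_recursive (recursive_nat_rec (recursive_nth 1 0) (recursive_const 1 0)
  (recursive_nth 3 0)) => v /=.
by case: (nth 0 v 0).
Qed.

Lemma recursive2_sub : recursive2 subn.
Proof.
apply: eq_recursive (recursive_nat_rec (recursive_nth 2 1) (recursive_nth 2 0)
  (recursive_comp1 recursive_pred (recursive_nth 4 1))) => v /=.
by elim: (nth 0 v 1) => [|k /= ->]; rewrite ?subn0 ?subnS.
Qed.

(** The quotient of [a] by [b] is the least [k] with [a < b * k.+1]. The outer factor [b] makes the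
    minimized function vanish at [k = 0] when [b = 0], in accordance with [a %/ 0 = 0]. *)
Lemma recursive2_div : recursive2 divn.
Proof.
have r : recursive (fun v : 3.-tuple nat =>
    ((nth 0 v 1).+1 - nth 0 v 2 * (nth 0 v 0).+1) * nth 0 v 2).
  apply: (recursive_comp2 recursive2_mul); last exact: recursive_nth.
  apply: (recursive_comp2 recursive2_sub).
    exact/recursive_succ/recursive_nth.
  apply: (recursive_comp2 recursive2_mul); first exact: recursive_nth.
  exact/recursive_succ/recursive_nth.
apply: (rec_mu r) => v /=.
move: (nth 0 v 0) (nth 0 v 1) => a [|b].
  by rewrite divn0 muln0.
split=> [|k].
  apply/eqP; rewrite muln_eq0 orbF subn_eq0 mulnC.
  by rewrite ltn_ceil.
rewrite leq_divRL // => le_k; apply/eqP; rewrite muln_eq0 orbF subn_eq0 -ltnNge.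
by rewrite ltnS mulnC.
Qed.

Lemma recursive_odd : recursive (fun v : 1.-tuple nat => (odd (nth 0 v 0) : nat)).
Proof.
apply: eq_recursive (recursive_nat_rec (recursive_nth 1 0) (recursive_const 1 0)
  (recursive_comp2 recursive2_sub (recursive_const 3 1) (recursive_nth 3 1))) => v /=.
by elim: (nth 0 v 0) => [|k /= ->] //; case: odd.
Qed.

Definition bit t i : bool := odd (t %/ 2 ^ i).

Lemma recursive2_bit : recursive2 (fun t i => bit t i).
Proof.
apply: (recursive_comp1 (f := fun x => odd x) recursive_odd).
apply: (recursive_comp2 recursive2_div).
  exact: recursive_nth.
apply: (recursive_comp2 recursive2_exp); first exact: recursive_const.
exact: recursive_nth.
Qed.

Lemma recursive2_pair_code : recursive2 pair_code.
Proof.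
have r (b := fun v : 2.-tuple nat => nth 0 v 0 + nth 0 v 1) :
    recursive (fun v => ((b v).+1 * b v) %/ 2 + nth 0 v 0).
  have rb : recursive b by exact: recursive2_add.
  apply: (recursive_comp2 recursive2_add); last exact: recursive_nth.
  apply: (recursive_comp2 recursive2_div); last exact: recursive_const.
  by apply: (recursive_comp2 recursive2_mul) => //; apply: recursive_succ.
by apply: eq_recursive r => v; rewrite /pair_code bin2 divn2.
Qed.

(* Variables are named by numbers, so that an environment restricted to the
   names below [M] is an [M]-tuple. *)
Inductive tm : Type :=
| TVar of nat
| TCst of nat
| TOp f of recursive2 f & tm & tm.

Inductive fm : Type :=
| FBot
| FEq of tm & tm
| FAnd of fm & fm
| FImp of fm & fm
| FAll of nat & tm & fm.

Definition upd (e : nat -> nat) x z y := if y == x then z else e y.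

Fixpoint teval (a : tm) (e : nat -> nat) : nat :=
  match a with
  | TVar x => e x
  | TCst c => c
  | @TOp f _ a b => f (teval a e) (teval b e)
  end.

Fixpoint fsat (p : fm) (e : nat -> nat) : Prop :=
  match p with
  | FBot => False
  | FEq a b => teval a e = teval b e
  | FAnd p q => fsat p e /\ fsat q e
  | FImp p q => fsat p e -> fsat q e
  | FAll x b p => forall z, z < teval b e -> fsat p (upd e x z)
  end.

(** A quantified name must be a component of the [M]-tuple, since [upd] overwrites it; a free name
    beyond the tuple reads the default 0 of [nth]. *)
Fixpoint bound_names_below M (p : fm) : bool :=
  match p with
  | FBot | FEq _ _ => true
  | FAnd p q | FImp p q => bound_names_below M p && bound_names_below M q
  | FAll x _ p => (x < M) && bound_names_below M p
  end.

Lemma recursive_teval M a : recursive (fun v : M.-tuple nat => teval a (nth 0 v)).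
Proof.
elim: a => [x|c|f rf a IHa b IHb] /=.
- exact: recursive_nth.
- exact: recursive_const.
- exact: recursive_comp2.
Qed.

(** With truth values 0 and 1 the connectives are arithmetical operations, and a bounded quantifier
    is a product computed by primitive recursion. *)
Lemma recursive_fsat M p : bound_names_below M p ->
  recursive (fun v : M.-tuple nat => (`[<fsat p (nth 0 v)>] : nat)).
Proof.
elim: p => [|a b|p IHp q IHq|p IHp q IHq|x b p IHp] /=.
- move=> _; apply: eq_recursive (recursive_const _ 0) => v.
  by case: asboolP.
- move=> _; have ra := @recursive_teval M a; have rb := @recursive_teval M b.
  apply: eq_recursive (recursive_comp2 recursive2_sub (recursive_const _ 1)
    (recursive_comp2 recursive2_add (recursive_comp2 recursive2_sub ra rb)
       (recursive_comp2 recursive2_sub rb ra))) => v.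
  move: (teval a _) (teval b _) => {ra rb a b} a b.
  case: asboolP => [->|/eqP]; first by rewrite !subnn.
  rewrite neq_ltn -[a < b]subn_gt0 -[b < a]subn_gt0 => /orP[] lt; apply/eqP; rewrite subn_eq0.
    exact: leq_trans lt (leq_addl _ _).
  exact: leq_trans lt (leq_addr _ _).
- case/andP=> /IHp rp /IHq rq.
  apply: eq_recursive (recursive_comp2 recursive2_mul rp rq) => v.
  by rewrite mulnb -asbool_and.
- case/andP=> /IHp rp /IHq rq.
  apply: eq_recursive (recursive_comp2 recursive2_sub (recursive_const _ 1)
    (recursive_comp2 recursive2_mul rp (recursive_comp2 recursive2_sub
       (recursive_const _ 1) rq))) => v.
  rewrite [in RHS]asbool_imply /=.
  by case: (`[<fsat p _>]); case: (`[<fsat q _>]).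
- case/andP=> lt_xM /IHp rp.
  (* Arguments 0 and 1 are the counter and the accumulated product; the environment starts at 2. *)
  pose g (i : 'I_M) (w : M.+2.-tuple nat) :=
    if i == x :> nat then nth 0 w 0 else nth 0 w i.+2.
  have rg i : recursive (g i).
    by rewrite /g; case: eqP => _; apply: recursive_nth.
  apply: eq_recursive (recursive_nat_rec (@recursive_teval M b)
    (recursive_const _ 1) (recursive_comp2 recursive2_mul
      (recursive_nth M.+2 1) (rec_comp rp rg))) => v /=.
  have eg k acc : nth 0 [tuple g i [tuple of k :: acc :: v] | i < M]
      = upd (nth 0 v) x k.
    apply/funext => y; rewrite /upd; case: (ltnP y M) => [lt_yM|le_My].
      by rewrite -(tnth_nth 0 _ (Ordinal lt_yM)) tnth_mktuple /g /=; case: eqP.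
    rewrite !nth_default ?size_tuple //.
    by case: eqP le_My lt_xM => // ->; rewrite leqNgt => /negbTE ->.
  elim: (teval b _) => [|m IHm] /=; first by rewrite asboolT.
  rewrite IHm eg mulnb -asbool_and; congr nat_of_bool.
  apply: asbool_equiv_eq; split=> [[hm hp] z|h].
    by rewrite ltnS leq_eqVlt => /predU1P[->|/hm].
  by split=> [z lt_z|]; apply: h; rewrite // ltnS ltnW.
Qed.

(** * Bits of numbers and estimates for codes *)

Lemma exists_bits n (P : nat -> bool) :
  exists2 t, t < 2 ^ n & bit t =1 (fun i => (i < n) && P i).
Proof.
elim: n P => [|n IHn] P.
  by exists 0 => // i; rewrite /bit div0n.
have [t lt_t bt] := IHn (fun i => P i.+1).
exists (P 0 + t.*2).
  by rewrite expnS mul2n -ltn_half_double half_bit_double.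
case=> [|i]; rewrite /bit; first by rewrite divn1 oddD odd_double addbF oddb.
by rewrite expnS divnMA divn2 half_bit_double -/(bit t i) bt.
Qed.

Lemma leq_pair_code a b c d : a <= c -> b <= d -> pair_code a b <= pair_code c d.
Proof.
move=> le_ac le_bd; rewrite /pair_code leq_add // leq_bin2l // ltnS.
exact: leq_add.
Qed.

Lemma pair_code_gt a b : 0 < a -> b < pair_code a b.
Proof.
move=> a_gt0; rewrite /pair_code binS bin1.
apply: leq_trans (leq_addr _ _); apply: leq_trans (leq_addl _ _).
by rewrite -[b.+1]add1n leq_add2r.
Qed.

(** * Kripke semantics *)

Local Open Scope classical_set_scope.

Lemma modal_predicate_logic_smallest G :
  modal_predicate_logic (smallest modal_predicate_logic G).
Proof.
split; rewrite /smallest /bigcap /=.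
- by move=> A B L [/mpl_ax1 h _].
- by move=> A B C L [/mpl_ax2 h _].
- by move=> A L [/mpl_dne h _].
- by move=> A y L [/mpl_inst h _].
- by move=> A B L [/mpl_allK h _].
- by move=> L [/mpl_K h _].
- by move=> A B hAB hA L hL; apply: (mpl_mp hL.1); [apply: hAB|apply: hA].
- by move=> A hA L hL; apply: (mpl_gen hL.1); apply: hA.
- by move=> A hA L hL; apply: (mpl_nec hL.1); apply: hA.
- by move=> s A hA L hL; apply: (mpl_subst hL.1); apply: hA.
Qed.

Definition scons (a : nat) (g : nat -> nat) k := if k is k'.+1 then g k' else a.

Section Kripke.
Variables (W : Type) (R : W -> W -> Prop) (D : W -> nat -> Prop).

Fixpoint psat (V : nat -> W -> Prop) (w : W) (A : pform) : Prop :=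
  match A with
  | PVar i => V i w
  | PBot => False
  | PImp B C => psat V w B -> psat V w C
  | PBox B => forall v, R w v -> psat V v B
  end.

Definition pvalid : set pform := [set A | forall V w, psat V w A].

Fixpoint sat (I : nat -> seq nat -> W -> Prop) (w : W) (g : nat -> nat)
    (A : form) : Prop :=
  match A with
  | Atom i ys => I i (map g ys) w
  | Bot => False
  | Imp B C => sat I w g B -> sat I w g C
  | Box B => forall v, R w v -> sat I v g B
  | All B => forall a, D w a -> sat I w (scons a g) B
  end.

(** The variables take values that exist at [w], as instantiation requires. Since an assignment
    gives every variable a value, a world with empty domain imposes no condition. *)
Definition valid : set form :=
  [set A | forall I w g, (forall j, D w (g j)) -> sat I w g A].

Lemma psat_subst V w s A :
  psat V w (prop_subst s A) <-> psat (fun i v => psat V v (s i)) w A.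
Proof.
elim: A w => [i||B IHB C IHC|B IHB] w //=; first by rewrite IHB IHC.
by split=> h v /h /IHB.
Qed.

Lemma normal_pvalid : normal_logic pvalid.
Proof.
split=> /=.
- by move=> A B V w /=; auto.
- by move=> A B C V w /=; auto.
- by move=> A V w /=; exact: contrapT.
- by move=> V w /= h1 h2 v wv; apply: h1 (h2 v wv).
- by move=> A B hAB hA V w; apply: hAB (hA _ _).
- by move=> A hA V w v _; apply: hA.
- by move=> s A hA V w; apply/psat_subst.
Qed.

Lemma pvalid_plus L A : L `<=` pvalid -> pvalid A -> plus L A `<=` pvalid.
Proof.
move=> hL hA; apply: smallest_sub normal_pvalid _ => B [/hL|/= ->] //.
Qed.

Lemma pvalid_logicK : logicK `<=` pvalid.
Proof. exact: smallest_sub normal_pvalid _. Qed.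

Lemma sat_form_of_pform I w g A :
  sat I w g (form_of_pform A) <-> psat (fun i => I i [::]) w A.
Proof.
elim: A w => [i||B IHB C IHC|B IHB] w //=; first by rewrite IHB IHC.
by split=> h v /h /IHB.
Qed.

Lemma sat_rename I w g r A : sat I w g (rename r A) <-> sat I w (g \o r) A.
Proof.
elim: A w g r => [i ys||B IHB C IHC|B IHB|B IHB] w g r //=.
- by rewrite map_comp.
- by rewrite IHB IHC.
- by split=> h v /h /IHB.
- have e a : scons a g \o up r = scons a (g \o r) by apply/funext=> -[].
  by split=> h a Da; [rewrite -e; apply/IHB|apply/IHB; rewrite e]; apply: h.
Qed.

(** The default of [nth] supplies the parameters: an index beyond the argument places is read in
    [g]. *)
Definition subst_interp I (s : nat -> nat -> form) g i (ys : seq nat) w :=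
  sat I w (fun k => nth (g (k - size ys)) ys k) (s i (size ys)).

Lemma sat_pred_subst I w g s A :
  sat I w g (pred_subst s A) <-> sat (subst_interp I s g) w g A.
Proof.
elim: A w g s => [i ys||B IHB C IHC|B IHB|B IHB] w g s //=.
- rewrite sat_rename /subst_interp size_map.
  suff -> : g \o (fun k => nth (k - size ys) ys k)
          = (fun k => nth (g (k - size ys)) (map g ys) k) by [].
  apply/funext=> k /=; case: (ltnP k (size ys)) => [lt_k|le_k].
    by rewrite (nth_map (k - size ys)) //; apply: set_nth_default; rewrite ?size_map.
  by rewrite !nth_default ?size_map.
- by rewrite IHB IHC.
- by split=> h v /h /IHB.
- set s' := fun i n => rename _ _.
  (* The renumbering of parameters in [s'] cancels the individual that [scons] puts in front. *)
  suff e a : subst_interp I s' (scons a g) = subst_interp I s g.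
    by split=> h a Da; [rewrite -(e a); apply/IHB|apply/IHB; rewrite e]; apply: h.
  apply/funext=> i; apply/funext=> ys; apply/funext=> v; apply/propext.
  rewrite /subst_interp /s' sat_rename.
  suff -> : (fun k => nth (scons a g (k - size ys)) ys k) \o
      (fun k => if k < size ys then k else k.+1)
      = (fun k => nth (g (k - size ys)) ys k) by [].
  apply/funext=> k /=; case: (ltnP k (size ys)) => [lt_k|le_k].
    exact: set_nth_default.
  by rewrite !nth_default ?(leq_trans le_k) ?subSn.
Qed.

Hypothesis D_mono : forall w v a, R w v -> D w a -> D v a.

(** Monotonicity of the domains serves necessitation: an assignment at a world must remain one at
    its successors. *)
Lemma modal_predicate_logic_valid : modal_predicate_logic valid.
Proof.
split=> /=.
- by move=> A B I w g _ /=; auto.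
- by move=> A B C I w g _ /=; auto.
- by move=> A I w g _ /=; exact: contrapT.
- move=> A y I w g Dg /= h; rewrite sat_rename.
  suff -> : g \o (fun k => if k is k'.+1 then k' else y) = scons (g y) g by apply: h.
  by apply/funext=> -[].
- move=> A B I w g Dg /= h hA a Da; apply: h => //; rewrite sat_rename.
  exact: hA.
- by move=> I w g Dg /= h1 h2 v wv; apply: h1 (h2 v wv).
- by move=> A B hAB hA I w g Dg; apply: hAB (hA _ _ _ _).
- move=> A hA I w g Dg a Da; apply: hA => -[|j] //=; exact: Dg.
- by move=> A hA I w g Dg v wv; apply: hA => j; apply: D_mono wv (Dg j).
- by move=> s A hA I w g Dg; apply/sat_pred_subst; apply: hA.
Qed.

Lemma valid_Q L : L `<=` pvalid -> Q L `<=` valid.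
Proof.
move=> hL; apply: smallest_sub modal_predicate_logic_valid _ => _ [A /hL hA <-].
by move=> I w g _; apply/sat_form_of_pform.
Qed.

Lemma valid_QC L : L `<=` pvalid ->
  (forall w v a, R w v -> D v a -> D w a) -> QC L `<=` valid.
Proof.
move=> hL D_const; apply: smallest_sub modal_predicate_logic_valid _ => A.
case=> [/(valid_Q hL)//|/= ->] I w g _ /= h v wv a Da.
exact: h (D_const _ _ _ wv Da) _ wv.
Qed.

End Kripke.

(** * One-variable formulas as bimodal formulas *)

Fixpoint unstar (A : bform) : form :=
  match A with
  | BVar i => Atom i [:: 0]
  | BBot => Bot
  | BImp B C => Imp (unstar B) (unstar C)
  | BBox B => Box (unstar B)
  | BBlackBox B => All (unstar B)
  end.

Lemma unstarK A : star (unstar A) = A.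
Proof. by elim: A => //= [B -> C ->|B ->|B ->]. Qed.

Lemma one_variable_unstar A : one_variable (unstar A).
Proof. by elim: A => //= B -> C ->. Qed.

Lemma starK A : one_variable A -> unstar (star A) = A.
Proof.
elim: A => [i ys /eqP -> //||B IHB C IHC|B IHB|B IHB] //=.
- by case/andP=> /IHB -> /IHC ->.
- by move=> /IHB ->.
- by move=> /IHB ->.
Qed.

(** [unstar] inverts [star] on one-variable formulas, so [A] comes from a single predicate
    formula. *)
Lemma one_variable_fragmentE L A : one_variable_fragment L A <-> L (unstar A).
Proof.
split=> [[B [LB oneB] <-]|LA]; first by rewrite starK.
by exists (unstar A); [split=> //; exact: one_variable_unstar|exact: unstarK].
Qed.

Lemma rename_unstar r A : r 0 = 0 -> rename r (unstar A) = unstar A.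
Proof.
elim: A r => [i||B IHB C IHC|B IHB|B IHB] r r0 //=.
- by rewrite r0.
- by rewrite IHB ?IHC.
- by rewrite IHB.
- by rewrite IHB.
Qed.

(** * The bimodal logic of the fragment *)

Definition BNot A := BImp A BBot.

(* The formulas whose truth value does not depend on the individual. *)
Fixpoint bclosed (A : bform) : bool :=
  match A with
  | BVar _ => false
  | BBot => true
  | BImp B C => bclosed B && bclosed C
  | BBox B => bclosed B
  | BBlackBox _ => true
  end.

(** [as_closed] contains axioms 4 and 5 for [BBlackBox]; applied to [BBox (BBlackBox A)], it yields
    the converse Barcan formula. *)
Record ath_s5_logic (T : set bform) : Prop := AthS5Logic {
  as_ax1 : forall A B, T (BImp A (BImp B A));
  as_ax2 : forall A B C,
    T (BImp (BImp A (BImp B C)) (BImp (BImp A B) (BImp A C)));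
  as_dne : forall A, T (BImp (BNot (BNot A)) A);
  as_mp : forall A B, T (BImp A B) -> T A -> T B;
  as_nec : forall A, T A -> T (BBox A);
  as_K : forall A B, T (BImp (BBox (BImp A B)) (BImp (BBox A) (BBox B)));
  as_Ath : forall A, T (BImp (BNot (BBox (BNot (BNot (BBox (BNot A))))))
                             (BBox (BNot (BBox (BNot A)))));
  as_bnec : forall A, T A -> T (BBlackBox A);
  as_bK : forall A B,
    T (BImp (BBlackBox (BImp A B)) (BImp (BBlackBox A) (BBlackBox B)));
  as_bT : forall A, T (BImp (BBlackBox A) A);
  as_closed : forall A, bclosed A -> T (BImp A (BBlackBox A)) }.

Definition bimodal_barcan (T : set bform) :=
  forall A, T (BImp (BBlackBox (BBox A)) (BBox (BBlackBox A))).

Lemma rename_closed r A : bclosed A -> rename r (unstar A) = unstar A.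
Proof.
elim: A r => [i||B IHB C IHC|B IHB|B IHB] r //=.
- by case/andP=> /IHB -> /IHC ->.
- by move=> /IHB ->.
- by rewrite rename_unstar.
Qed.

Lemma rename_id A : rename id A = A.
Proof.
have e : up id = id by apply/funext=> -[].
by elim: A => [i ys||B IHB C IHC|B IHB|B IHB] //=;
  rewrite ?map_id ?IHB ?IHC // e IHB.
Qed.

Section PredicateLogic.
Variables (L : set form) (hL : modal_predicate_logic L).

Let mp A B : L (Imp A B) -> L A -> L B := mpl_mp hL (A := A) (B := B).
Let k A B : L B -> L (Imp A B) := mp (mpl_ax1 hL B A).
Let s A B C : L (Imp A (Imp B C)) -> L (Imp A B) -> L (Imp A C).
Proof. by move=> h; apply: mp (mp (mpl_ax2 hL A B C) h). Qed.

Lemma mpl_K_inst A B : L (Imp (Box (Imp A B)) (Imp (Box A) (Box B))).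
Proof.
have := mpl_subst hL (fun i _ => if i is 0 then A else B) (mpl_K hL).
have e : (fun n => nth (n - 0) [::] n) = id.
  by apply/funext => n; rewrite nth_nil subn0.
by rewrite /= e !rename_id.
Qed.

Lemma mpl_inst_unstar A : L (Imp (All (unstar A)) (unstar A)).
Proof.
by have := mpl_inst hL (unstar A) 0; rewrite /inst rename_unstar.
Qed.

Lemma mpl_all_imp A B : bclosed A -> L (Imp (unstar A) (unstar B)) ->
  L (Imp (unstar A) (All (unstar B))).
Proof.
move=> cA hAB; have := mpl_allK hL (unstar A) (unstar B).
rewrite /shift rename_closed // => h; apply: mp h _.
exact: mpl_gen.
Qed.

Lemma ath_s5_logic_unstar : L (form_of_pform Ath) ->
  ath_s5_logic (fun A => L (unstar A)).
Proof.
move=> hAth; split => /=.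
- by move=> A B; apply: mpl_ax1.
- by move=> A B C; apply: mpl_ax2.
- by move=> A; apply: mpl_dne.
- by move=> A B; apply: mp.
- by move=> A; apply: mpl_nec.
- by move=> A B; apply: mpl_K_inst.
- move=> A; have := mpl_subst hL (fun _ _ => unstar A) hAth.
  have e : (fun n => nth (n - 0) [::] n) = id.
    by apply/funext => n; rewrite nth_nil subn0.
  by rewrite /= e !rename_id.
- by move=> A; apply: mpl_gen.
(* [mpl_allK] distributes a quantifier only over a constant antecedent. Hence [B] is first derived
   from [S] and [All A], both closed, and then generalized past each of them. *)
- move=> A B; set S := All _.
  have h : L (Imp S (Imp (All (unstar A)) (unstar B))).
    have hS := mpl_inst_unstar (BImp A B).
    apply: s (s (k _ (mpl_ax2 hL _ _ _)) _) (k _ (mpl_inst_unstar A)).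
    exact: s (k _ (mpl_ax1 hL _ _)) hS.
  have h2 : L (Imp S (All (Imp (All (unstar A)) (unstar B)))).
    exact: (mpl_all_imp (A := BBlackBox (BImp A B)) (B := BImp (BBlackBox A) B)).
  apply: s h2; apply: k.
  have := mpl_allK hL (All (unstar A)) (unstar B).
  by rewrite /shift (rename_closed _ (A := BBlackBox A)).
- by move=> A; apply: mpl_inst_unstar.
- move=> A cA; apply: mpl_all_imp => //.
  exact: s (mpl_ax1 hL _ (Imp (unstar A) (unstar A))) (mpl_ax1 hL _ _).
Qed.

Lemma bimodal_barcan_unstar : L Barcan -> bimodal_barcan (fun A => L (unstar A)).
Proof.
move=> hB A /=; have := mpl_subst hL (fun _ _ => unstar A) hB.
by rewrite /= !rename_unstar.
Qed.

End PredicateLogic.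

(** * Maximal consistent sets *)

Section Canonical.
Variables (T : set bform) (hT : ath_s5_logic T).

(** Necessitation is not applied to hypotheses; this is what makes the deduction theorem hold. *)
Inductive Cl (G : set bform) : set bform :=
| Cl_hyp A : G A -> Cl G A
| Cl_thm A : T A -> Cl G A
| Cl_mp A B : Cl G (BImp A B) -> Cl G A -> Cl G B.

Lemma Cl_k G A B : Cl G B -> Cl G (BImp A B).
Proof. by apply: Cl_mp; apply: Cl_thm; apply: as_ax1. Qed.

Lemma Cl_s G A B C : Cl G (BImp A (BImp B C)) -> Cl G (BImp A B) -> Cl G (BImp A C).
Proof. by move=> h; apply: Cl_mp; apply: Cl_mp h; apply: Cl_thm; apply: as_ax2. Qed.

Lemma Cl_deduction G A B : Cl (G `|` [set A]) B -> Cl G (BImp A B).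
Proof.
elim=> {B} [B [GB|/= ->]|B TB|B C _ hBC _ hB].
- exact/Cl_k/Cl_hyp.
- exact: Cl_s (Cl_thm _ (as_ax1 hT _ (BImp A A))) (Cl_thm _ (as_ax1 hT _ _)).
- exact/Cl_k/Cl_thm.
- exact: Cl_s hBC hB.
Qed.

Lemma Cl_sub G H B : G `<=` H -> Cl G B -> Cl H B.
Proof.
move=> sGH; elim=> {B} [B /sGH|B|B C _ hBC _ hB]; first exact: Cl_hyp.
  exact: Cl_thm.
exact: Cl_mp hBC hB.
Qed.

Lemma Cl_dne G A : Cl (G `|` [set BNot A]) BBot -> Cl G A.
Proof. by move/Cl_deduction; apply: Cl_mp; apply: Cl_thm; apply: as_dne. Qed.

Lemma Cl_hyp_last G A : Cl (G `|` [set A]) A.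
Proof. by apply: Cl_hyp; right. Qed.

Lemma Cl_weak G A B : Cl G B -> Cl (G `|` [set A]) B.
Proof. by apply: Cl_sub; left. Qed.

Lemma Cl_bot G A : Cl G BBot -> Cl G A.
Proof. by move=> h; apply/Cl_dne/Cl_weak. Qed.

Lemma Cl_case G A B : Cl G (BImp A B) -> Cl G (BImp (BNot A) B) -> Cl G B.
Proof.
move=> h1 h2; apply: Cl_dne; apply: Cl_mp (Cl_hyp_last _ _) _.
apply: Cl_mp (Cl_weak _ h2) _; apply: Cl_deduction.
apply: Cl_mp (Cl_weak _ (Cl_hyp_last _ _)) _.
by apply: Cl_mp (Cl_hyp_last _ _); do 2!apply: Cl_weak.
Qed.

Record mcs := MCS {
  mcs_set :> bform -> Prop;
  mcs_thm : forall A, T A -> mcs_set A;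
  mcs_mp : forall A B, mcs_set (BImp A B) -> mcs_set A -> mcs_set B;
  mcs_bot : ~ mcs_set BBot;
  mcs_max : forall A, mcs_set A \/ mcs_set (BNot A) }.

Section Separation.
Variables G D : set bform.
Hypothesis D_inh : exists A, D A.
Hypothesis D_dir : forall A B, D A -> D B ->
  exists C, [/\ D C, T (BImp A C) & T (BImp B C)].

Definition avoids H := forall A, D A -> ~ Cl H A.

(** As codes are injective, each stage adds at most one formula; a number that codes no formula adds
    nothing. *)
Fixpoint lind n : set bform :=
  if n is n'.+1 then
    lind n' `|` [set A | code A = n' /\ avoids (lind n' `|` [set A])]
  else G.

Lemma lind_mono m n : m <= n -> lind m `<=` lind n.
Proof.
elim: n => [|n IHn]; first by rewrite leqn0 => /eqP ->.
by rewrite leq_eqVlt => /predU1P[-> //|/IHn h A /h]; left.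
Qed.

Lemma avoids_lind n : avoids G -> avoids (lind n).
Proof.
move=> avG; elim: n => [//|n IHn] A DA.
have [[B [cB avB]]|no] := pselect (exists B, code B = n /\ avoids (lind n `|` [set B])).
  move=> hA; apply: (avB _ DA); apply: Cl_sub hA => C [] ; first by left.
  by case=> cC _; right; apply: code_inj; rewrite cC.
move=> hA; apply: (IHn _ DA); apply: Cl_sub hA => C [] //= hC.
by case: no; exists C.
Qed.

Let U : set bform := fun A => exists n, lind n A.

Lemma Cl_lim A : Cl U A -> exists n, Cl (lind n) A.
Proof.
elim=> {A} [A [n hA]|A TA|A B _ [m hAB] _ [n hA]].
- by exists n; apply: Cl_hyp.
- by exists 0; apply: Cl_thm.
- exists (maxn m n); apply: Cl_mp (Cl_sub _ hAB) (Cl_sub _ hA);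
    by apply: lind_mono; rewrite ?leq_maxl ?leq_maxr.
Qed.

(** Lindenbaum's construction, avoiding a whole set [D]. If neither [A] nor its negation could be
    added, each would imply a member of [D], so a common upper bound of the two members would
    already be derivable. *)
Lemma separation : avoids G -> exists x : mcs, G `<=` mcs_set x /\ forall A, D A -> ~ x A.
Proof.
move=> avG.
have avU : avoids U.
  by move=> A DA /Cl_lim[n]; apply: avoids_lind.
have dec A : Cl U A \/ exists2 B, D B & Cl U (BImp A B).
  have [av|] := pselect (avoids (lind (code A) `|` [set A])).
    by left; apply: Cl_hyp; exists (code A).+1; right.
  move=> /existsNP[B /not_implyP[DB /contrapT hB]]; right; exists B => //.
  by apply: Cl_sub (Cl_deduction hB) => C; exists (code A).
have [B0 DB0] := D_inh.
unshelve eexists.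
  apply: (MCS (mcs_set := Cl U)) => [A|A B||A].
  - exact: Cl_thm.
  - exact: Cl_mp.
  - by move/(Cl_bot B0); apply: avU.
  - have [|[B DB hB]] := dec A; first by left.
    have [|[C DC hC]] := dec (BNot A); first by right.
    have [E [DE hBE hCE]] := D_dir DB DC.
    case: (avU _ DE); apply: (@Cl_case _ A).
      exact: Cl_s (Cl_k _ (Cl_thm _ hBE)) hB.
    exact: Cl_s (Cl_k _ (Cl_thm _ hCE)) hC.
split=> [A GA|A DA]; first by apply: Cl_hyp; exists 0.
exact: avU.
Qed.

End Separation.

Lemma Cl_mcs (x : mcs) G A : G `<=` mcs_set x -> Cl G A -> x A.
Proof.
move=> sGx; elim=> {A} [A /sGx|A|A B _ hAB _ hA] //; first exact: mcs_thm.
exact: mcs_mp hAB hA.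
Qed.

Lemma mcs_imp (x : mcs) A B : x (BImp A B) <-> (x A -> x B).
Proof.
split; first exact: mcs_mp.
move=> h; have [xA|xNA] := mcs_max x A.
  by apply: Cl_mcs (Cl_k _ (Cl_hyp (h xA))).
apply: (@Cl_mcs x (mcs_set x)) => //; apply: Cl_deduction; apply: Cl_bot.
exact: Cl_mp (Cl_weak _ (Cl_hyp xNA)) (Cl_hyp_last _ _).
Qed.

Lemma mcs_not (x : mcs) A : x (BNot A) <-> ~ x A.
Proof.
rewrite mcs_imp; split=> [h /h|h /h //]; exact: mcs_bot.
Qed.

Definition mrel (x y : mcs) := forall A, x (BBox A) -> y A.
Definition msim (x y : mcs) := forall A, x (BBlackBox A) -> y A.

Lemma Cl_box (x : mcs) A : Cl (fun B => x (BBox B)) A -> x (BBox A).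
Proof.
elim=> {A} [A //|A TA|A B _ hAB _ hA]; first exact/mcs_thm/(as_nec hT).
exact: mcs_mp (mcs_mp (mcs_thm x (as_K hT A B)) hAB) hA.
Qed.

Lemma Cl_bbox (x : mcs) A : Cl (fun B => x (BBlackBox B)) A -> x (BBlackBox A).
Proof.
elim=> {A} [A //|A TA|A B _ hAB _ hA]; first exact/mcs_thm/(as_bnec hT).
exact: mcs_mp (mcs_mp (mcs_thm x (as_bK hT A B)) hAB) hA.
Qed.

Lemma T_imp_refl A : T (BImp A A).
Proof.
exact: (as_mp hT (as_mp hT (as_ax2 hT _ (BImp A A) _) (as_ax1 hT _ _)) (as_ax1 hT _ _)).
Qed.

Lemma separation1 G A : ~ Cl G A -> exists x : mcs, G `<=` mcs_set x /\ ~ x A.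
Proof.
move=> nGA; have [||B ->//|x [Gx nxA]] := @separation G [set A].
- by exists A.
- by move=> _ _ -> ->; exists A; split => //; exact: T_imp_refl.
- by exists x; split=> //; apply: nxA.
Qed.

Lemma mcs_box (x : mcs) A : x (BBox A) <-> forall y, mrel x y -> y A.
Proof.
split=> [xA y xy|h]; first exact: xy.
apply: contrapT => nxA.
have [|y [xy nyA]] := @separation1 (fun B => x (BBox B)) A.
  by move/Cl_box.
exact/nyA/h.
Qed.

Lemma mcs_bbox (x : mcs) A : x (BBlackBox A) <-> forall y, msim x y -> y A.
Proof.
split=> [xA y xy|h]; first exact: xy.
apply: contrapT => nxA.
have [|y [xy nyA]] := @separation1 (fun B => x (BBlackBox B)) A.
  by move/Cl_bbox.
exact/nyA/h.
Qed.

Lemma mcs_closed (x : mcs) A : bclosed A -> x A -> x (BBlackBox A).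
Proof. by move=> cA; apply/mcs_imp/mcs_thm/(as_closed hT). Qed.

Lemma msim_closed x y A : msim x y -> bclosed A -> x A <-> y A.
Proof.
move=> xy cA; split=> [xA|yA]; first exact/xy/mcs_closed.
apply: contrapT => /mcs_not nxA.
have /mcs_not // : y (BNot A) by apply/xy/mcs_closed => //=; rewrite cA.
Qed.

Lemma msim_refl x : msim x x.
Proof. by move=> A; apply/mcs_imp/mcs_thm/(as_bT hT). Qed.

Lemma msim_sym x y : msim x y -> msim y x.
Proof.
move=> xy A yA; apply: (@msim_refl x).
by apply/(msim_closed xy).
Qed.

Lemma msim_trans x y z : msim x y -> msim y z -> msim x z.
Proof. by move=> xy yz A xA; apply: yz; apply/(msim_closed xy). Qed.

(** If [z] contains [BBox A] but [u] lacks [A], then two diamonds before the negation of [A] hold at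
    [x]; by Ath, [z] contains the diamond of that negation, a contradiction. *)
Lemma mrel_ath x y z u : mrel x y -> mrel x z -> mrel y u -> mrel z u.
Proof.
move=> xy xz yu A zA; apply: contrapT => nuA.
have dd : x (BNot (BBox (BNot (BNot (BBox (BNot (BNot A))))))).
  apply/mcs_not => /xy /mcs_not; apply; apply/mcs_not => /yu /mcs_not; apply.
  exact/mcs_not.
have /xz/mcs_not : x (BBox (BNot (BBox (BNot (BNot A))))).
  exact: mcs_mp (mcs_thm x (as_Ath hT (BNot A))) dd.
apply; apply/mcs_box => v zv; apply/mcs_not => /mcs_not; apply; exact: zv.
Qed.

(* A point that avoids the closed formulas false at [y] is similar to [y]. *)
Lemma confluence x x' y : msim x x' -> mrel x y -> exists2 y', mrel x' y' & msim y' y.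
Proof.
move=> xx' xy; pose D := [set A | bclosed A /\ ~ y A].
have [||A [cA nyA] /Cl_box|y' [x'y' av]] := @separation (fun B => x' (BBox B)) D.
- by exists BBot; split=> //; apply: mcs_bot.
- move=> A B [cA nA] [cB nB]; exists (BImp (BNot A) B); split.
  + split=> /=; first by rewrite cA cB.
    by move/mcs_imp => h; apply/nB/h/mcs_not.
  + have : Cl set0 (BImp A (BImp (BNot A) B)).
      apply/Cl_deduction/Cl_deduction/Cl_bot.
      exact: Cl_mp (Cl_hyp_last _ _) (Cl_weak _ (Cl_hyp_last _ _)).
    by elim=> // C E _ hCE _; apply: (as_mp hT).
  + exact: as_ax1.
- by rewrite -(msim_closed xx') // => /xy.
exists y' => // A y'A; apply: msim_refl; apply: contrapT => nyA.
by case: (av (BBlackBox A)).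
Qed.

(** The point [x'] has to avoid every [BBox A] with [A] false at [y']. Were such a [BBox A] forced
    by the black boxes of [x], the Barcan formula would put [BBlackBox A] into [y], hence [A] into
    [y']. *)
Lemma barcan_back x y y' : bimodal_barcan T ->
  mrel x y -> msim y y' -> exists2 x', msim x x' & mrel x' y'.
Proof.
move=> hB xy yy'; pose D := [set BBox A | A in [set A | ~ y' A]].
have [||_ [A nyA <-] /Cl_bbox xA|x' [xx' av]] :=
    @separation (fun B => x (BBlackBox B)) D.
- by exists (BBox BBot); exists BBot => //; apply: mcs_bot.
- move=> _ _ [A nA <-] [B nB <-]; exists (BBox (BImp (BNot A) B)).
  split; last first.
  + by apply: (as_mp hT) (as_K hT _ _) _; apply: as_nec => //; apply: as_ax1.
  + apply: (as_mp hT) (as_K hT _ _) _; apply: as_nec => //.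
    have : Cl set0 (BImp A (BImp (BNot A) B)).
      apply/Cl_deduction/Cl_deduction/Cl_bot.
      exact: Cl_mp (Cl_hyp_last _ _) (Cl_weak _ (Cl_hyp_last _ _)).
    by elim=> // C E _ hCE _; apply: (as_mp hT).
  + exists (BImp (BNot A) B) => //= /mcs_imp h.
    exact/nB/h/mcs_not.
- apply/nyA/yy'/xy; exact: mcs_mp (mcs_thm x (hB A)) xA.
exists x' => // A x'A; apply: contrapT => nyA.
by apply: av x'A; exists A.
Qed.

End Canonical.

Local Close Scope classical_set_scope.

(** * Finite models *)

Fixpoint box_depth (A : bform) : nat :=
  match A with
  | BVar _ | BBot => 0
  | BImp B C => maxn (box_depth B) (box_depth C)
  | BBox B => (box_depth B).+1
  | BBlackBox B => box_depth B
  end.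

Lemma pair_code_gel a b : a <= pair_code a b.
Proof. exact: leq_addl. Qed.

Lemma pair_code_ger a b : b <= pair_code a b.
Proof.
rewrite /pair_code binS bin1; apply: leq_trans (leq_addr _ _).
exact: leq_trans (leq_addl a b) (leq_addl _ _).
Qed.

Lemma box_depth_code A : box_depth A <= code A.
Proof.
elim: A => [i||B IHB C IHC|B IHB|B IHB] //=.
- rewrite geq_max; have le := ltnW (@pair_code_gt 2 (pair_code (code B) (code C)) isT).
  apply/andP; split; apply: leq_trans le.
    exact: leq_trans IHB (pair_code_gel _ _).
  exact: leq_trans IHC (pair_code_ger _ _).
- by apply: leq_ltn_trans IHB _; apply: pair_code_gt.
- by apply: leq_trans IHB (ltnW _); apply: pair_code_gt.
Qed.

Lemma enum_rank_nat_inj (U : finType) (x y : U) :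
  enum_rank x = enum_rank y :> nat -> x = y.
Proof. by move/val_inj/enum_rank_inj. Qed.

Section LevelModel.
Variables (cd : bool) (K N A : nat).
Variables (T : nat -> nat -> nat -> nat -> Prop) (D : nat -> nat -> nat -> Prop).
Variable F : nat -> Prop.

(* [D k i a]: the individual [a] exists at the [i]-th world of level [k];
   [T c k i a]: the formula with code [c] is true of it.  Worlds with an empty
   domain are absent, and [F] singles out the numbers treated as codes, as
   there are numbers that are not codes of formulas.  [cd] stands for constant
   domains. *)
Definition tarski : Prop :=
  forall k, k < K -> forall i, i < N -> forall a, a < N -> D k i a ->
  (T (pair_code 1 0) k i a -> False) /\
  (forall c, c < 1 + A -> forall b, b < 1 + A -> forall e, e < 1 + A ->
        c = pair_code 2 (pair_code b e) -> F c ->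
        F b /\ F e /\ (T c k i a <-> (T b k i a -> T e k i a))) /\
  (forall c, c < 1 + A -> forall b, b < 1 + A -> c = pair_code 3 b -> F c ->
        F b /\ (T c k i a <->
          forall k', k' < K -> k' = 1 + k ->
          forall i', i' < N -> forall a', a' < N -> D k' i' a' -> T b k' i' a)) /\
  (forall c, c < 1 + A -> forall b, b < 1 + A -> c = pair_code 4 b -> F c ->
        F b /\ (T c k i a <-> forall a', a' < N -> D k i a' -> T b k i a')) /\
  (forall k', k' < K -> k' = 1 + k ->
      forall i', i' < N -> forall a', a' < N -> D k' i' a' ->
        D k' i' a /\ (cd = 1 :> nat -> D k i a')).

End LevelModel.

(** * The finite model of types and kinds *)

Section FiniteModel.
Variables (T : set bform) (hT : ath_s5_logic T) (cd : bool).
Hypothesis T_barcan : cd -> bimodal_barcan T.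
Notation mcs := (mcs T).
Variables (x0 : mcs) (A K : nat).

Fixpoint level n (y : mcs) : Prop :=
  if n is n'.+1 then exists x z, [/\ level n' x, mrel x z & msim z y]
  else msim x0 y.

Fixpoint steps n (x y : mcs) : Prop :=
  if n is n'.+1 then exists2 z, steps n' x z & mrel z y else x = y.

Lemma level_sim n x y : msim x y -> level n x -> level n y.
Proof.
case: n => [|n] /= xy; first by move=> /msim_trans; apply.
move=> [u [z [lu uz zx]]]; exists u, z; split=> //; exact: msim_trans zx xy.
Qed.

Lemma level_rel n x y : level n x -> mrel x y -> level n.+1 y.
Proof. by move=> lx xy; exists x, y; split=> //; apply: msim_refl. Qed.

Lemma level_steps k n x y : level k x -> steps n x y -> level (k + n) y.
Proof.
elim: n y => [|n IHn] y lx; first by rewrite addn0 => <-.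
case=> z xz zy; rewrite addnS; apply: level_rel zy; exact: IHn.
Qed.

(** Every cluster of a level sees every cluster of the next. By induction a common predecessor sees
    points of both lower clusters, Ath transfers the successor from one to the other, and confluence
    moves it to [x] itself. *)
Lemma level_succ n x y : level n x -> level n.+1 y ->
  exists2 y', mrel x y' & msim y' y.
Proof.
elim: n x y => [|n IHn] x y.
  move=> /= x0x [x1 [y1 [x0x1 x1y1 y1y]]].
  have [y' xy' y'y1] := confluence hT (msim_trans hT (msim_sym hT x0x1) x0x) x1y1.
  by exists y' => //; apply: msim_trans y'y1 y1y.
move=> [x3 [x2 [lx3 x3x2 x2x]]] [x1 [y1 [lx1 x1y1 y1y]]].
have [x1' x3x1' x1'x1] := IHn _ _ lx3 lx1.
have [y1' x1'y1' y1'y1] := confluence hT (msim_sym hT x1'x1) x1y1.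
have x2y1' := mrel_ath hT x3x1' x3x2 x1'y1'.
have [y' xy' y'y1'] := confluence hT x2x x2y1'.
by exists y' => //; apply: msim_trans y'y1' (msim_trans hT y1'y1 y1y).
Qed.

(** By induction the predecessors of [y] and [z] have the same successors, so [y] and [z] share a
    predecessor and Ath applies. *)
Lemma steps_succ n x y z u : steps n x y -> steps n x z -> mrel y u -> mrel z u.
Proof.
elim: n y z u => [|n IHn] y z u /=; first by move=> <- <-.
move=> [y1 xy1 y1y] [z1 xz1 z1z]; apply: mrel_ath y1y _ => //.
exact: IHn xz1 xy1 z1z.
Qed.

Lemma steps_level k x y : level 0 x -> level k y -> exists2 z, steps k x z & msim z y.
Proof.
move=> lx; elim: k y => [|k IHk] y.
  by move=> ly; exists x => //; apply: msim_trans (msim_sym hT lx) ly.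
move=> ly; have [u [v [lu uv vy]]] := ly.
have [z xz zu] := IHk _ lu.
have [y' zy' y'y] := level_succ (level_sim (msim_sym hT zu) lu) ly.
by exists y' => //; exists z.
Qed.

(** With the Barcan formula [y] can be traced back to level 0 inside the clusters; otherwise [y] is
    taken as its own origin. *)
Lemma level_origin k y : level k y ->
  exists j x, [/\ j <= k, cd -> j = 0, level j x & steps (k - j) x y].
Proof.
case hcd: cd; last by exists k, y; rewrite subnn.
move=> ly; exists 0; suff [x lx xy] : exists2 x, level 0 x & steps k x y.
  by exists x; rewrite subn0.
elim: k y ly => [|k IHk] y; first by exists y.
move=> [u [v [lu uv vy]]]; have [u' uu' u'y] := barcan_back hT (T_barcan hcd) uv vy.
by have [x lx xu'] := IHk _ (level_sim uu' lu); exists x => //; exists u'.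
Qed.

Definition ty := {ffun 'I_A.+1 -> bool}.
(** Used in two ways. In a kind, the pair describes a point: the types of its cluster and its own
    type. As a world of the finite model, its second component is a selector, combined by [label]
    with the selector that ends an [indiv]. *)
Definition wtype := ({set ty} * ty)%type.
Definition kind := (K.-tuple {set wtype})%type.
Definition indiv := ('I_K * kind * ty)%type.

Definition tp (y : mcs) : ty := [ffun i : 'I_A.+1 => `[<exists C, code C = i /\ y C>]].

Definition cluster (y : mcs) : {set ty} :=
  [set t | `[<exists2 z, msim y z & tp z = t>]].

Definition kind_of (y : mcs) : kind :=
  [tuple [set St : wtype | `[<exists2 c, steps n y c & (cluster c, tp c) = St>]]
  | n < K].

(* A pointwise sum: for fixed [j] it ranges over all types when [s] does, and
   vice versa. *)
Definition xor (s j : ty) : ty := [ffun i => s i (+) j i].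

Lemma xorK s t : xor s (xor s t) = t.
Proof. by apply/ffunP=> i; rewrite !ffunE addbA addbb. Qed.

Lemma xorC s t : xor s t = xor t s.
Proof. by apply/ffunP=> i; rewrite !ffunE addbC. Qed.

(** Selectors do not affect existence: some point of a cluster with types [w.1] must be reached from
    the first point of [a] in [k - j] steps. *)
Definition indom (k : nat) (w : wtype) (a : indiv) : Prop :=
  let: (j, q, s) := a in
  [/\ j <= k, cd -> j = 0 :> nat, exists2 y, level j y & kind_of y = q
    & exists t, (w.1, t) \in nth finset.set0 q (k - j)].

(** The two selectors together propose a type; if it is not realized, any realized one is taken.
    Thus varying the world exhausts the types possible for an individual, and varying the individual
    those possible at a world. *)
Definition label (k : nat) (w : wtype) (a : indiv) : ty :=
  let: (j, q, s) := a in
  let X := nth finset.set0 q (k - j) in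
  if (w.1, xor s w.2) \in X then xor s w.2 else
  odflt s [pick t | (w.1, t) \in X].

Lemma tpE y C : code C <= A -> tp y (inord (code C)) <-> y C.
Proof.
move=> leCA; rewrite ffunE inordK //; split=> [/asboolP[C' [/code_inj -> //]]|yC].
by apply/asboolP; exists C.
Qed.

Lemma mem_kind_of y n S t : n < K ->
  (S, t) \in nth finset.set0 (kind_of y) n <->
  exists c, [/\ steps n y c, cluster c = S & tp c = t].
Proof.
move=> ltnK; rewrite -[n]/(val (Ordinal ltnK)) nth_mktuple inE.
split=> [/asboolP[c yc [<- <-]]|[c [yc <- <-]]]; first by exists c.
by apply/asboolP; exists c.
Qed.

Lemma mem_cluster y t : t \in cluster y <-> exists2 z, msim y z & tp z = t.
Proof. by rewrite inE; split=> /asboolP. Qed.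

Lemma cluster_sim y z : msim y z -> cluster y = cluster z.
Proof.
move=> yz; apply/setP=> t; apply/idP/idP => /mem_cluster[u h e];
  apply/mem_cluster; exists u => //.
  exact: msim_trans (msim_sym hT yz) h.
exact: msim_trans yz h.
Qed.

Lemma label_kind k w (j : 'I_K) (q : kind) s : (exists t, (w.1, t) \in nth finset.set0 q (k - j)) ->
  (w.1, label k w (j, q, s)) \in nth finset.set0 q (k - j).
Proof.
move=> [t ht]; rewrite /label; case: ifP => //= _.
by case: pickP => [//|/(_ t)]; rewrite ht.
Qed.

Lemma sub_lt k j : k < K -> k - j < K.
Proof. exact/leq_ltn_trans/leq_subr. Qed.

Lemma indom_label k w (j : 'I_K) y s : k < K -> indom k w (j, kind_of y, s) ->
  exists c, [/\ steps (k - j) y c, cluster c = w.1 & tp c = label k w (j, kind_of y, s)].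
Proof.
by move=> ltkK [_ _ _ /label_kind h]; apply/(mem_kind_of _ _ _ (sub_lt j ltkK)).
Qed.

Lemma indomP k w (j : 'I_K) y s : k < K -> j <= k -> (cd -> j = 0 :> nat) -> level j y ->
  indom k w (j, kind_of y, s) <-> exists2 c, steps (k - j) y c & cluster c = w.1.
Proof.
move=> ltkK lejk j0 ly; split=> [/indom_label[] // c [yc cw _]|[c yc cw]].
  by exists c.
split=> //; first by exists y.
by exists (tp c); apply/(mem_kind_of _ _ _ (sub_lt j ltkK)); exists c.
Qed.

Lemma indom_level k w a : k < K -> indom k w a -> exists2 c, level k c & cluster c = w.1.
Proof.
case: a => [[j q] s] ltkK h; have [lejk j0 [y ly eq] _] := h.
move: h; rewrite -eq => /(indomP w s ltkK lejk j0 ly)[c yc cw].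
by exists c => //; rewrite -(subnKC lejk); apply: level_steps yc.
Qed.

(** As [w'] is inhabited, it comes from a cluster of level [k.+1], in which [level_succ] finds a
    successor of the point representing [a]. *)
Lemma indom_mono k w w' a b : k.+1 < K ->
  indom k w a -> indom k.+1 w' b -> indom k.+1 w' a.
Proof.
case: a => [[j q] s] ltkK h /(indom_level ltkK)[d ld dw'].
have [lejk j0 [y ly eq] _] := h; move: h; rewrite -eq.
move=> /(indomP w s (ltnW ltkK) lejk j0 ly)[c yc cw].
have lc : level k c by rewrite -(subnKC lejk); apply: level_steps yc.
have [d' cd' d'd] := level_succ lc ld.
apply/indomP => //; first exact: ltnW; exists d'; last by rewrite (cluster_sim d'd).
by rewrite subSn //; exists c.
Qed.

(** With constant domains [a] starts at level 0, from which [steps_level] reaches every cluster of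
    level [k]. *)
Lemma indom_const k w w' a b : cd -> k.+1 < K ->
  indom k.+1 w' a -> indom k w b -> indom k w a.
Proof.
case: a => [[j q] s] hcd ltkK [_ /(_ hcd) j0 [y ly eq] _].
move=> /(indom_level (ltnW ltkK))[c lc cw]; move: ly; rewrite j0 => ly.
have [z yz zc] := steps_level ly lc.
rewrite -eq; apply/indomP; rewrite ?j0 //; first exact: ltnW.
by rewrite subn0; exists z => //; rewrite (cluster_sim zc).
Qed.

(** In the clause for [BBox], the individual [b] only attests that [w'] is inhabited. *)
Fixpoint msat (C : bform) k (w : wtype) (a : indiv) : Prop :=
  match C with
  | BVar _ => label k w a (inord (code C))
  | BBot => False
  | BImp B C => msat B k w a -> msat C k w a
  | BBox B => k.+1 < K -> forall w' b, indom k.+1 w' b -> msat B k.+1 w' a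
  | BBlackBox B => forall b, indom k w b -> msat B k w b
  end.

(** The label of [a] is the type of a point [c] reached from its first point, so the claim is
    reduced to membership in [c]. The last hypothesis ensures that cutting the model at [K] loses
    nothing: either no point lies there, or the boxes of [C] do not reach that far. *)
Lemma truth C k w a : code C <= A -> k < K -> indom k w a ->
  (forall y, ~ level K y) \/ box_depth C + k < K ->
  msat C k w a <-> label k w a (inord (code C)).
Proof.
elim: C k w a => [i||B IHB C IHC|B IHB|B IHB] k w a leCA ltkK domwa hK //;
  case: a domwa => [[j q] s] h; have [lejk j0 [y ly eq] _] := h;
  subst q; have [c [yc cw tpc]] := indom_label ltkK h;
  rewrite -tpc tpE //; have lc : level k c by
    (rewrite -(subnKC lejk); apply: level_steps yc).
- by split=> // /mcs_bot.
- rewrite /= in leCA; have leBCA := leq_trans (ltnW (@pair_code_gt 2 _ isT)) leCA.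
  have leBA := leq_trans (pair_code_gel _ _) leBCA.
  have leCA' := leq_trans (pair_code_ger _ _) leBCA.
  have hKB : (forall y, ~ level K y) \/ box_depth B + k < K.
    by case: hK => [|h']; [left|right; apply: leq_ltn_trans h'; rewrite leq_add2r leq_maxl].
  have hKC : (forall y, ~ level K y) \/ box_depth C + k < K.
    by case: hK => [|h']; [left|right; apply: leq_ltn_trans h'; rewrite leq_add2r leq_maxr].
  rewrite mcs_imp // /= IHB ?IHC // -tpc !tpE //.
- rewrite /= in leCA; have leBA := leq_trans (ltnW (@pair_code_gt 3 _ isT)) leCA.
  split=> [hmsat|cB ltk'K w' b domb].
    apply/mcs_box => // c' cc'; have lc' := level_rel lc cc'.
    have ltk'K : k.+1 < K.
      case: hK => [emp|]; last by rewrite /= addSn; apply: leq_ltn_trans; rewrite ltnS leq_addl.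
      by rewrite ltn_neqAle ltkK andbT; apply/eqP => eK; apply: (emp c'); rewrite -eK.
    (* This selector makes [tp c'] the label of the individual at [w']. *)
    pose w' : wtype := (cluster c', xor s (tp c')).
    have yc' : steps (k.+1 - j) y c' by rewrite subSn //; exists c.
    have hw' : (w'.1, tp c') \in nth finset.set0 (kind_of y) (k.+1 - j).
      by apply/mem_kind_of; [exact: sub_lt|exists c'].
    have dom' : indom k.+1 w' (j, kind_of y, s).
      by apply/indomP => //; [exact: leqW|exists c'].
    have /(IHB _ _ _ leBA ltk'K dom') := hmsat ltk'K w' _ dom'.
    rewrite /label xorK hw' tpE //; apply.
    by case: hK => [|h']; [left|right; rewrite addnS].
  have dom' := indom_mono ltk'K h domb.
  apply/(IHB _ _ _ leBA ltk'K dom').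
    by case: hK => [|h']; [left|right; rewrite addnS].
  have [c' [yc' c'w' tpc']] := indom_label ltk'K dom'.
  (* The predecessor [z] of [c'] need not be [c], but both are reached from [y] in [k - j] steps and
     so have the same successors. *)
  rewrite -tpc' tpE //; move: yc'; rewrite subSn // => -[z yz zc'].
  exact: (steps_succ yz yc zc') cB.
- rewrite /= in leCA; have leBA := leq_trans (ltnW (@pair_code_gt 4 _ isT)) leCA.
  split=> [hmsat|cB b domb].
    apply/mcs_bbox => // c' cc'; have lc' := level_sim cc' lc.
    have [j' [y' [lej'k j'0 ly' y'c']]] := level_origin lc'.
    have ltj'K : j' < K by exact: leq_ltn_trans lej'k ltkK.
    have hw : (w.1, tp c') \in nth finset.set0 (kind_of y') (k - j').
      apply/mem_kind_of; first exact: sub_lt.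
      by exists c'; rewrite -(cluster_sim cc').
    (* The selector of [b] cancels that of [w], leaving the label [tp c']. *)
    pose b : indiv := (Ordinal ltj'K, kind_of y', xor (tp c') w.2).
    have domb : indom k w b.
      by apply/indomP => //; exists c'; rewrite -?(cluster_sim cc').
    have /(IHB _ _ _ leBA ltkK domb hK) := hmsat b domb.
    by rewrite /b /label [xor (tp c') _]xorC [xor (xor _ _) _]xorC xorK hw tpE.
  apply/(IHB _ _ _ leBA ltkK domb hK); case: b domb => [[j' q] s'] h'.
  have [lej'k j'0 [y' ly' eq] _] := h'; subst q.
  have [c' [yc' c'w' tpc']] := indom_label ltkK h'.
  (* The points [c] and [c'] may lie in different clusters with the same set of types; a point
     similar to [c] with the type of [c'] replaces [c']. *)
  have /mem_cluster[c3 cc3 e] : tp c' \in cluster c.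
    by rewrite cw -c'w'; apply/mem_cluster; exists c' => //; apply: msim_refl.
  by rewrite -tpc' -e tpE //; apply: cc3.
Qed.

Definition root_world : wtype := (cluster x0, [ffun=> false]).

Lemma root_refutes C : code C <= A -> 0 < K -> ~ x0 C ->
  (forall y, ~ level K y) \/ box_depth C < K ->
  exists2 a, indom 0 root_world a & ~ msat C 0 root_world a.
Proof.
move=> leCA K0 nC hK; pose a : indiv := (Ordinal K0, kind_of x0, tp x0).
have l0 : level 0 x0 by apply: msim_refl.
have doma : indom 0 root_world a by apply/indomP => //; exists x0.
exists a => //; rewrite truth // ?addn0 // /a /label.
have -> : xor (tp x0) root_world.2 = tp x0 by apply/ffunP=> i; rewrite !ffunE addbF.
have /= -> : (root_world.1, tp x0) \in nth finset.set0 (kind_of x0) (0 - 0).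
  by apply/mem_kind_of; [|exists x0].
by rewrite tpE.
Qed.

Definition Dnum (k i a : nat) : Prop := k < K /\
  exists (w : wtype) (x : indiv), [/\ i = enum_rank w, a = enum_rank x & indom k w x].

Definition Tnum (c k i a : nat) : Prop := [/\ k < K, c <= A &
  exists C (w : wtype) (x : indiv), [/\ c = code C, i = enum_rank w, a = enum_rank x & msat C k w x]].

Definition Fnum c := c <= A /\ exists C, c = code C.

Lemma DnumE k (w : wtype) (x : indiv) :
  Dnum k (enum_rank w) (enum_rank x) <-> k < K /\ indom k w x.
Proof.
split=> [[ltkK [w' [x' []]]]|[ltkK h]]; last by split=> //; exists w, x.
by move=> /enum_rank_nat_inj <- /enum_rank_nat_inj <-.
Qed.

Lemma TnumE C k (w : wtype) (x : indiv) :
  Tnum (code C) k (enum_rank w) (enum_rank x) <->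
  [/\ k < K, code C <= A & msat C k w x].
Proof.
split=> [[ltkK leCA [C' [w' [x' []]]]]|[ltkK leCA h]]; last first.
  by split=> //; exists C, w, x.
by move=> /code_inj <- /enum_rank_nat_inj <- /enum_rank_nat_inj <-.
Qed.

Lemma tarski_num N : #|{: wtype}| <= N -> #|{: indiv}| <= N ->
  tarski cd K N A Tnum Dnum Fnum.
Proof.
move=> hw hx k ltkK _ _ _ _ [_ [w [x [-> -> domx]]]].
refine (conj _ (conj _ (conj _ (conj _ _)))).
- by rewrite -[pair_code 1 0]/(code BBot) TnumE => -[].
- move=> c lec b _ e _ ec [_ [C eC]].
  move: ec lec; rewrite eC {c eC}; case: C => [?||B E|?|?] /= /pair_code_inj[] // _ /pair_code_inj[<- <-] lec.
  have lec' : code (BImp B E) <= A by [].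
  have leBA : code B <= A.
    exact: leq_trans (leq_trans (pair_code_gel _ _) (pair_code_ger _ _)) lec'.
  have leEA : code E <= A.
    exact: leq_trans (leq_trans (pair_code_ger _ _) (pair_code_ger _ _)) lec'.
  split; [by split=> //; exists B|split; first by split=> //; exists E].
  rewrite -[pair_code 2 _]/(code (BImp B E)) !TnumE /=.
  by split=> [[_ _ h] [_ _ /h]|h]; split=> // hB; case: h.
- move=> c lec b _ ec [_ [C eC]].
  move: ec lec; rewrite eC {c eC}; case: C => [?||? ?|B|?] /= /pair_code_inj[] // _ <- lec.
  have lec' : code (BBox B) <= A by [].
  have leBA : code B <= A by exact: leq_trans (pair_code_ger _ _) lec'.
  split; first by split=> //; exists B.
  rewrite -[pair_code 3 _]/(code (BBox B)) TnumE /=.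
  split=> [[_ _ h] k' ltk'K ek' i' _ a' _ [_ [w' [v [-> _ domv]]]]|h].
    by subst k'; apply/TnumE; split=> //; apply: h domv.
  split=> // ltk'K w' v domv.
  have [] // := iffLR (TnumE B k.+1 w' x).
  apply: (h k.+1 ltk'K erefl _ _ (enum_rank v)).
  + exact: leq_trans (ltn_ord _) hw.
  + exact: leq_trans (ltn_ord _) hx.
  + exact/DnumE.
- move=> c lec b _ ec [_ [C eC]].
  move: ec lec; rewrite eC {c eC}; case: C => [?||? ?|?|B] /= /pair_code_inj[] // _ <- lec.
  have lec' : code (BBlackBox B) <= A by [].
  have leBA : code B <= A by exact: leq_trans (pair_code_ger _ _) lec'.
  split; first by split=> //; exists B.
  rewrite -[pair_code 4 _]/(code (BBlackBox B)) TnumE /=.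
  split=> [[_ _ h] a' _ /= [_ [w' [v [/enum_rank_nat_inj <- -> domv]]]]|h].
    by apply/TnumE; split=> //; apply: h domv.
  split=> // v domv.
  have [] // := iffLR (TnumE B k w v).
  apply: h; last exact/DnumE.
  exact: leq_trans (ltn_ord _) hx.
- move=> k' ltk'K ek' i' _ a' _ [_ [w' [v [-> -> domv]]]]; subst k'.
  split; first by apply/DnumE; split=> //; apply: indom_mono ltk'K domx domv.
  move=> hcd; apply/DnumE; split=> //; apply: (indom_const _ ltk'K domv domx).
  by case: cd hcd.
Qed.

Lemma num_refutes N C : #|{: wtype}| <= N -> #|{: indiv}| <= N ->
  code C <= A -> 0 < K -> ~ x0 C ->
  (forall y, ~ level K y) \/ box_depth C < K ->
  exists i a, [/\ i < N, a < N, Dnum 0 i a & ~ Tnum (code C) 0 i a].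
Proof.
move=> hw hx leCA K0 nC hK; have [a doma nsat] := root_refutes leCA K0 nC hK.
exists (enum_rank root_world), (enum_rank a); split.
- exact: leq_trans (ltn_ord _) hw.
- exact: leq_trans (ltn_ord _) hx.
- exact/DnumE.
- by rewrite TnumE => -[].
Qed.

Lemma card_ty : #|{: ty}| = 2 ^ A.+1.
Proof. by rewrite card_ffun card_bool card_ord. Qed.

Lemma card_powerset_type (U : finType) : #|{: {set U}}| = 2 ^ #|{: U}|.
Proof. by rewrite -[in RHS]cardsT -card_powerset finset.powersetT cardsT. Qed.

Lemma card_wtype : #|{: wtype}| = 2 ^ 2 ^ A.+1 * 2 ^ A.+1.
Proof. by rewrite card_prod card_powerset_type card_ty. Qed.

Lemma card_indiv :
  #|{: indiv}| = K * (2 ^ (2 ^ 2 ^ A.+1 * 2 ^ A.+1)) ^ K * 2 ^ A.+1.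
Proof.
by rewrite !card_prod card_tuple card_powerset_type card_wtype card_ord card_ty.
Qed.

End FiniteModel.

Local Open Scope classical_set_scope.

(** * Numerical models as Kripke models *)

Section Soundness.
Variables (cd : bool) (K N A : nat).
Variables (T : nat -> nat -> nat -> nat -> Prop) (D : nat -> nat -> nat -> Prop).
Variable F : nat -> Prop.
Hypothesis T_tarski : tarski cd K N A T D F.

Definition wdom (w : nat * nat) a := [/\ w.1 < K, w.2 < N, a < N & D w.1 w.2 a].
(** Both ends must be inhabited, because [tarski] compares only the domains of inhabited worlds. *)
Definition wrel (u v : nat * nat) :=
  [/\ v.1 = u.1.+1, exists a, wdom u a & exists a, wdom v a].

Lemma wdom_mono u v a : wrel u v -> wdom u a -> wdom v a.
Proof.
case: u v => [k i] [_ i'] [/= -> _ [a' [/= ltK lti' lta' Da']]] [/= ltkK lti lta Da].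
have [_ [_ [_ [_ h]]]] := T_tarski ltkK lti lta Da.
by split=> //; have [] := h k.+1 ltK erefl _ lti' _ lta' Da'.
Qed.

Lemma wdom_const u v a : cd -> wrel u v -> wdom v a -> wdom u a.
Proof.
case: u v => [k i] [_ i'] hcd [/= -> [b [/= ltkK lti ltb Db]] _] [/= ltK lti' lta Da].
have [_ [_ [_ [_ h]]]] := T_tarski ltkK lti ltb Db.
by split=> //; have [_] := h k.+1 ltK erefl _ lti' _ lta Da; apply; rewrite hcd.
Qed.

Definition interp i (ys : seq nat) (w : nat * nat) :=
  T (pair_code 0 i) w.1 w.2 (head 0 ys).

(** The clauses of [tarski] are the inductive truth conditions, and each hands [F] on to the
    immediate subformulas. *)
Lemma tarski_sat C w a g : code C <= A -> F (code C) -> wdom w a -> g 0 = a ->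
  T (code C) w.1 w.2 a <-> sat wrel wdom interp w g (unstar C).
Proof.
elim: C w a g => [i||B IHB C IHC|B IHB|B IHB] w a g leCA FC wa ga;
  have [ltkK lti lta Da] := wa;
  have [h1 [h2 [h3 [h4 _]]]] := T_tarski ltkK lti lta Da.
- by rewrite /= /interp /= ga.
- by split.
- have leBA : code B <= A.
    exact: leq_trans (leq_trans (pair_code_gel _ _) (pair_code_ger _ _)) leCA.
  have leCA' : code C <= A.
    exact: leq_trans (leq_trans (pair_code_ger _ _) (pair_code_ger _ _)) leCA.
  have [FB [FC' e]] := h2 _ leCA _ leBA _ leCA' erefl FC.
  rewrite /= -(IHB w a g) // -(IHC w a g) //.
- have leBA : code B <= A by exact: leq_trans (pair_code_ger _ _) leCA.
  have [FB e] := h3 _ leCA _ leBA erefl FC.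
  rewrite /=; apply: (iff_trans e); split=> [h [k' i'] wv|h k' ltk' ek' i' lti' a' lta' Da'].
    have [/= ek' _ [b vb]] := wv; have [/= ltk'K lti' ltb Db] := vb.
    apply/IHB; [by []|by []|exact: wdom_mono wv wa|by []|].
    exact: h ek' _ lti' _ ltb Db.
  have wv : wrel w (k', i') by split=> //; [exists a|exists a'].
  have /(IHB (k', i') a) := h _ wv; apply=> //; exact: wdom_mono wv wa.
- have leBA : code B <= A by exact: leq_trans (pair_code_ger _ _) leCA.
  have [FB e] := h4 _ leCA _ leBA erefl FC.
  rewrite /=; apply: (iff_trans e); split=> [h b wb|h b ltb Db].
    have [_ _ ltb Db] := wb.
    by apply/IHB; [by []|by []|exact: wb|by []|exact: h].
  have wb : wdom w b by [].
  by have /(IHB w b) := h _ wb; apply.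
Qed.

Lemma valid_tarski C i a : valid wrel wdom (unstar C) -> code C <= A ->
  F (code C) -> 0 < K -> i < N -> a < N -> D 0 i a -> T (code C) 0 i a.
Proof.
move=> vC leCA FC K0 lti lta Da; have wa : wdom (0, i) a by [].
by apply/(tarski_sat (w := (0, i)) (g := fun=> a)) => //; apply: vC.
Qed.

(** Between inhabited worlds [wrel] depends on the levels alone, so all successors of [u] have the
    same successors. *)
Lemma pvalid_Ath : pvalid wrel Ath.
Proof.
move=> V u /= h v uv hv; apply: h => v' uv' h'; apply: h' => w v'w.
apply: hv; have [ew _ hw] := v'w; have [ev' _ _] := uv'; have [ev _ hv] := uv.
by split; rewrite // ew ev' ev.
Qed.

(** Each step raises the level by one, and every successor has a level below [K]. *)
Lemma pvalid_iter_PBox n : 0 < n -> K = n -> pvalid wrel (iter n PBox PBot).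
Proof.
move=> n0 Kn V w; have: K <= w.1 + n by rewrite Kn leq_addl.
case: n n0 {Kn} => // n _; elim: n w => [|n IHn] w leK /= v [ev _ [a [ltK _ _ _]]].
  by move: ltK; rewrite ev ltnNge; rewrite addn1 in leK; rewrite leK.
by apply: IHn; rewrite ev addSnnS.
Qed.

End Soundness.

(** * The decision procedure *)

(* The number of levels of the models searched: [n = m = 1] serves for K + Ath,
   where the modal depth of a formula is at most its code, and [m = 0] for
   height [n]. *)
Definition level_bound n m A := n + m * A.

(** The last two summands are the cardinals of [wtype] and [indiv]; the others make the bound exceed
    [A] and [K]. *)
Definition size_bound K A :=
  2 + A + K + 2 ^ 2 ^ (1 + A) * 2 ^ (1 + A)
  + K * (2 ^ (2 ^ 2 ^ (1 + A) * 2 ^ (1 + A))) ^ K * 2 ^ (1 + A).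

Definition in_bits t x : Prop := bit t x = 1 :> nat.

(** As [pair_code] is monotone, the exponents exceed the codes of all tuples with entries at most
    [N]; hence [t] and [d] range over all relations needed. *)
Definition refutation_free cd n m A : Prop :=
  let K := level_bound n m A in let N := size_bound K A in
  forall t, t < 2 ^ (1 + pair_code N (pair_code N (pair_code N N))) ->
  forall d, d < 2 ^ (1 + pair_code N (pair_code N N)) ->
  forall f, f < 2 ^ (1 + A) ->
  let T c k i a := in_bits t (pair_code c (pair_code k (pair_code i a))) in
  let D k i a := in_bits d (pair_code k (pair_code i a)) in
  tarski cd K N A T D (in_bits f) -> in_bits f A ->
  forall i, i < N -> forall a, a < N -> D 0 i a -> T A 0 i a.

Definition tadd := TOp recursive2_add.
Definition tmul := TOp recursive2_mul.
Definition texp := TOp recursive2_exp.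
Definition tpc := TOp recursive2_pair_code.
(* Name 0 is the code of the tested formula; names 1, 2 and 3 are the numbers
   whose bits give [T], [D] and [F]. *)
Definition t1A := tadd (TCst 1) (TVar 0).
Definition tK n m := tadd (TCst n) (tmul (TCst m) (TVar 0)).
Definition tN n m :=
  let p := texp (TCst 2) t1A in let w := tmul (texp (TCst 2) p) p in
  tadd (tadd (tadd (tadd (TCst 2) (TVar 0)) (tK n m)) w)
    (tmul (tmul (tK n m) (texp (texp (TCst 2) w) (tK n m))) p).
Definition fbit t x := FEq (TOp recursive2_bit (TVar t) x) (TCst 1).
Definition fT c k i a := fbit 1 (tpc c (tpc k (tpc i a))).
Definition fD k i a := fbit 2 (tpc k (tpc i a)).
Definition fF c := fbit 3 c.
Definition FIff p q := FAnd (FImp p q) (FImp q p).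

Definition tarski_fm (cd : bool) n m : fm :=
  let K := tK n m in let N := tN n m in
  let k := TVar 4 in let i := TVar 5 in let a := TVar 6 in
  let c := TVar 7 in let b := TVar 8 in let e := TVar 9 in
  let k' := TVar 10 in let i' := TVar 11 in let a' := TVar 12 in
  let next := FEq k' (tadd (TCst 1) k) in
  FAll 4 K (FAll 5 N (FAll 6 N (FImp (fD k i a)
  (FAnd (FImp (fT (TCst (pair_code 1 0)) k i a) FBot)
  (FAnd (FAll 7 t1A (FAll 8 t1A (FAll 9 t1A
    (FImp (FEq c (tpc (TCst 2) (tpc b e))) (FImp (fF c)
    (FAnd (fF b) (FAnd (fF e)
      (FIff (fT c k i a) (FImp (fT b k i a) (fT e k i a))))))))))
  (FAnd (FAll 7 t1A (FAll 8 t1A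
    (FImp (FEq c (tpc (TCst 3) b)) (FImp (fF c)
    (FAnd (fF b)
      (FIff (fT c k i a) (FAll 10 K (FImp next
        (FAll 11 N (FAll 12 N (FImp (fD k' i' a') (fT b k' i' a))))))))))))
  (FAnd (FAll 7 t1A (FAll 8 t1A
    (FImp (FEq c (tpc (TCst 4) b)) (FImp (fF c)
    (FAnd (fF b)
      (FIff (fT c k i a) (FAll 12 N (FImp (fD k i a') (fT b k i a')))))))))
  (FAll 10 K (FImp next (FAll 11 N (FAll 12 N (FImp (fD k' i' a')
    (FAnd (fD k' i' a) (FImp (FEq (TCst cd) (TCst 1)) (fD k i a'))))))))))))))).

Definition refutation_free_fm (cd : bool) n m : fm :=
  let N := tN n m in
  FAll 1 (texp (TCst 2) (tadd (TCst 1) (tpc N (tpc N (tpc N N)))))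
  (FAll 2 (texp (TCst 2) (tadd (TCst 1) (tpc N (tpc N N))))
  (FAll 3 (texp (TCst 2) t1A)
  (FImp (tarski_fm cd n m) (FImp (fF (TVar 0))
  (FAll 5 N (FAll 6 N (FImp (fD (TCst 0) (TVar 5) (TVar 6))
    (fT (TVar 0) (TCst 0) (TVar 5) (TVar 6))))))))).

(** Both sides are convertible: [tarski], [size_bound] and [refutation_free] follow the formula
    operation by operation, down to [1 + A] in place of [A.+1]. *)
Lemma refutation_free_fmE cd n m v :
  fsat (refutation_free_fm cd n m) v = refutation_free cd n m (v 0).
Proof. by []. Qed.

Lemma refutation_free_decidable cd n m S :
  (forall C, S C <-> refutation_free cd n m (code C)) -> decidable_set S.
Proof.
(* The formula uses the names 0 to 12; below, [g] puts the tested code at name 0 and zeros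
   elsewhere. *)
move=> SE; have := @recursive_fsat 13 (refutation_free_fm cd n m) isT.
pose g (i : 'I_13) (v : 1.-tuple nat) := if i == 0 :> nat then nth 0 v 0 else 0.
have rg i : recursive (g i).
  by rewrite /g; case: eqP => _; [apply: recursive_nth|apply: recursive_const].
move=> /rec_comp/(_ rg) rchi; exists (fun v => `[<refutation_free cd n m (nth 0 v 0)>]).
  apply: eq_recursive rchi => v; rewrite refutation_free_fmE.
  by rewrite (nth_mktuple _ 0 ord0).
by move=> C /=; split=> hC; [rewrite asboolT //; apply/SE|rewrite asboolF // => /SE].
Qed.

Definition QL (cd : bool) := if cd then QC else Q.

Lemma modal_predicate_logic_QL cd Lambda : modal_predicate_logic (QL cd Lambda).
Proof. case: cd; exact: modal_predicate_logic_smallest. Qed.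

Lemma sub_QL (cd : bool) Lambda A : Lambda A -> QL cd Lambda (form_of_pform A).
Proof.
have h : Q Lambda `<=` QL cd Lambda.
  by case: cd => // B QB; apply: sub_gen_smallest; left.
move=> LA; apply: h; apply: sub_gen_smallest.
by exists A.
Qed.

Lemma QL_barcan (cd : bool) Lambda : cd -> QL cd Lambda Barcan.
Proof. by case: cd => // _; apply: sub_gen_smallest; right. Qed.

Lemma valid_QL (W : Type) (R : W -> W -> Prop) (D : W -> nat -> Prop) (cd : bool) Lambda :
  (forall w v a, R w v -> D w a -> D v a) ->
  (cd -> forall w v a, R w v -> D v a -> D w a) ->
  Lambda `<=` pvalid R -> QL cd Lambda `<=` valid R D.
Proof.
case: cd => hm hc hL; last exact: valid_Q.
apply: valid_QC => //; exact: hc.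
Qed.

(** * The fragment and the absence of numerical countermodels *)

Section Fragment.
Variables (cd : bool) (Lambda : set pform) (n m : nat).
Let K A := level_bound n m A.
Let Th : set bform := fun A => QL cd Lambda (unstar A).
Hypothesis K_gt0 : forall A, 0 < K A.
Hypothesis Lambda_Ath : Lambda Ath.
Hypothesis Lambda_pvalid : forall A N D, Lambda `<=` pvalid (wrel (K A) N D).
Hypothesis Lambda_height : forall (x0 : mcs Th) C,
  (forall y, ~ level x0 (K (code C)) y) \/ box_depth C < K (code C).

Lemma refutation_free_sound C : Th C -> refutation_free cd n m (code C).
Proof.
move=> ThC K' N t _ d _ f _ T D htarski fC i lti a lta Da.
apply: (valid_tarski htarski) => //; last exact: K_gt0.
apply: (valid_QL (cd := cd) (Lambda := Lambda)) => //.
- by move=> w v b; exact: (wdom_mono htarski).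
- by move=> hcd w v b; exact: (wdom_const htarski).
- exact: Lambda_pvalid.
Qed.

Lemma exists_in_bits M (P : nat -> Prop) : (forall x, P x -> x < M) ->
  exists2 t, t < 2 ^ M & in_bits t = P.
Proof.
move=> PM; have [t lt_t bt] := exists_bits M (fun x => `[<P x>]).
exists t => //; apply/funext=> x; apply/propext; rewrite /in_bits bt.
by split=> [|Px]; [case: asboolP => //; rewrite andbF|rewrite PM // asboolT].
Qed.

(** If [C] is not a theorem, a maximal consistent set omits it, and the finite model built from that
    set, written as bits, is a forbidden countermodel. *)
Lemma refutation_free_complete C : refutation_free cd n m (code C) -> Th C.
Proof.
move=> hC; apply: contrapT => nC.
have hTh : ath_s5_logic Th.
  apply: ath_s5_logic_unstar; first exact: modal_predicate_logic_QL.
  exact: sub_QL.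
have hB : cd -> bimodal_barcan Th.
  move=> hcd; apply: bimodal_barcan_unstar; first exact: modal_predicate_logic_QL.
  exact: QL_barcan.
have [|x0 [_ nx0]] := @separation1 _ hTh set0 C.
  move=> h; apply: nC; elim: h => // A B _ hAB _; exact: (as_mp hTh).
pose A := code C; pose N := size_bound (K A) A.
have hw : #|{: wtype A}| <= N.
  rewrite card_wtype /N /size_bound add1n; apply: leq_trans (leq_addr _ _).
  exact: leq_addl.
have hx : #|{: indiv A (K A)}| <= N.
  by rewrite card_indiv /N /size_bound add1n leq_addl.
have AN : A < N by rewrite /N /size_bound -!addnA !addSn ltnS leqW // add0n leq_addr.
have KN : K A <= N by do 2!apply: leq_trans (leq_addr _ _); apply: leq_addl.
pose D := Dnum cd x0 A (K A); pose T := Tnum cd x0 A (K A).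
have D_N k i a : D k i a -> [/\ k <= N, i <= N & a <= N].
  move=> [ltkK [w [x [-> -> _]]]]; split; first exact: leq_trans (ltnW ltkK) KN.
    exact: leq_trans (ltnW (ltn_ord _)) hw.
  exact: leq_trans (ltnW (ltn_ord _)) hx.
have T_N c k i a : T c k i a -> [/\ c <= N, k <= N, i <= N & a <= N].
  move=> [ltkK lecA [E [w [x [_ -> -> _]]]]].
  split; [exact: leq_trans lecA (ltnW AN)|exact: leq_trans (ltnW ltkK) KN| |].
    exact: leq_trans (ltnW (ltn_ord _)) hw.
  exact: leq_trans (ltnW (ltn_ord _)) hx.
have [t lt_t tE] := @exists_in_bits (1 + pair_code N (pair_code N (pair_code N N)))
  (fun x => exists c k i a,
     x = pair_code c (pair_code k (pair_code i a)) /\ T c k i a)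
  (ltac:(move=> _ [c [k [i [a [-> /T_N[? ? ? ?]]]]]];
     rewrite add1n ltnS; do 3!apply: leq_pair_code => //)).
have [d lt_d dE] := @exists_in_bits (1 + pair_code N (pair_code N N))
  (fun x => exists k i a, x = pair_code k (pair_code i a) /\ D k i a)
  (ltac:(move=> _ [k [i [a [-> /D_N[? ? ?]]]]];
     rewrite add1n ltnS; do 2!apply: leq_pair_code => //)).
have [f lt_f fE] := @exists_in_bits (1 + A) (Fnum A) (fun x h => h.1).
have TE : (fun c k i a => in_bits t (pair_code c (pair_code k (pair_code i a)))) = T.
  apply/funext=> c; apply/funext=> k; apply/funext=> i; apply/funext=> a.
  rewrite tE; apply/propext; split=> [[c' [k' [i' [a' [e]]]]]|h]; last by exists c, k, i, a.
  by move: e => /pair_code_inj[-> /pair_code_inj[-> /pair_code_inj[-> ->]]].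
have DE : (fun k i a => in_bits d (pair_code k (pair_code i a))) = D.
  apply/funext=> k; apply/funext=> i; apply/funext=> a.
  rewrite dE; apply/propext; split=> [[k' [i' [a' [e]]]]|h]; last by exists k, i, a.
  by move: e => /pair_code_inj[-> /pair_code_inj[-> ->]].
have [i [a [lti lta Da nTa]]] := num_refutes hTh hB hw hx (leqnn A) (K_gt0 A) nx0
  (Lambda_height x0 C).
apply: nTa; have := hC t lt_t d lt_d f lt_f.
rewrite -/A -/(K A) -/N TE DE fE => /=; apply=> //; first exact: tarski_num.
by split=> //; exists C.
Qed.

Lemma fragment_decidable : decidable_set (one_variable_fragment (QL cd Lambda)).
Proof.
apply: (@refutation_free_decidable cd n m) => C.
rewrite one_variable_fragmentE; split; first exact: refutation_free_sound.
exact: refutation_free_complete.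
Qed.

End Fragment.

(** Iterated boxes of falsum are closed, hence shared by similar points, and each step along [mrel]
    removes one box. *)
Lemma level_iter_box (T : set bform) (hT : ath_s5_logic T) (x0 y : mcs T) n k :
  T (iter n BBox BBot) -> level x0 k y -> k <= n -> y (iter (n - k) BBox BBot).
Proof.
move=> Tn; have cl i : bclosed (iter i BBox BBot) by elim: i.
elim: k y => [|k IHk] y; first by rewrite subn0 => _ _; apply: mcs_thm.
move=> [x [z [lx xz zy]]] ltkn; apply/(msim_closed hT zy) => //.
by apply: xz; have := IHk x lx (ltnW ltkn); rewrite -(subnSK ltkn).
Qed.

Lemma pvalid_logicK_plus (W : Type) (R : W -> W -> Prop) A :
  pvalid R A -> plus logicK A `<=` pvalid R.
Proof. exact/pvalid_plus/pvalid_logicK. Qed.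

Lemma form_of_pform_iter_PBox n :
  form_of_pform (iter n PBox PBot) = unstar (iter n BBox BBot).
Proof. by elim: n => //= n ->. Qed.

Lemma QL_fragment_decidable (cd : bool) (Lambda : set pform) :
  Lambda = plus logicK Ath \/
  (exists n : nat, 1 <= n /\
     Lambda = plus (plus logicK (iter n PBox PBot)) Ath) ->
  decidable_set (one_variable_fragment (QL cd Lambda)).
Proof.
case=> [->|[n [n_gt0 ->]]].
  apply: (@fragment_decidable cd _ 1 1) => [A||A N D|x0 C].
  - by [].
  - by apply: sub_gen_smallest; right.
  - exact/pvalid_logicK_plus/pvalid_Ath.
  - by right; rewrite /level_bound mul1n add1n ltnS box_depth_code.
have e A : level_bound n 0 A = n by rewrite /level_bound mul0n addn0.
apply: (@fragment_decidable cd _ n 0) => [A||A N D|x0 C]; rewrite ?e //.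
- by apply: sub_gen_smallest; right.
- apply: pvalid_plus; last exact: pvalid_Ath.
  by apply: pvalid_logicK_plus; apply: pvalid_iter_PBox.
(* Level [n] is empty: a point there would contain falsum. *)
- left=> y ly; have hT : ath_s5_logic (fun A => QL cd
      (plus (plus logicK (iter n PBox PBot)) Ath) (unstar A)).
    apply: ath_s5_logic_unstar; first exact: modal_predicate_logic_QL.
    by apply: sub_QL; apply: sub_gen_smallest; right.
  have := level_iter_box (n := n) hT _ ly.
  rewrite subnn => h; apply: (@mcs_bot _ y); apply: h => //.
  rewrite -form_of_pform_iter_PBox; apply: sub_QL.
  by apply: sub_gen_smallest; left; apply: sub_gen_smallest; right.
Qed.

Theorem mainTheorem10 (Lambda : set pform)
  (hLambda : Lambda = plus logicK Ath \/
     exists n : nat, 1 <= n /\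
       Lambda = plus (plus logicK (iter n PBox PBot)) Ath) :
  decidable_set (one_variable_fragment (Q Lambda)) /\
  decidable_set (one_variable_fragment (QC Lambda)).
Proof.
split; first exact: (QL_fragment_decidable false).
exact: (QL_fragment_decidable true).
Qed.
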